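(* Let $p$ be a prime and let $G$ be a finite $p$-group with $d(G)=3$, $\Phi(G)\le Z(G)$, $G'\cong C_p^3$ and $G/G'$ of type $(p^{m_1},p^{m_2},p^{m_3})$ with $m_1>m_2=m_3$ and $m_2>1$ if $p=2$, and suppose $G$ is determined by one of the characteristic matrices (D1)–(D9), (E1)–(E15), (F1)–(F6) listed in the context. (1) If $I_{\min}=m_3$, then the characteristic matrix is one of: (D2)–(D4), (D6)–(D9), (E8)–(E9), (E12)–(E15). (2) If $I_{\min}=m_3+1$, then the characteristic matrix is one of: (D1), (D5), (E1)–(E7), (E10)–(E11), (F1)–(F4), (F6). (3) If $I_{\min}=m_3+2$, then the characteristic matrix is (F5). (4) If $I_{\max}=m_1+2$, then the characteristic matrix is one of: (E14)–(E15), (F1), (F4)–(F6). (5) If $I_{\max}=m_1+1$, then the characteristic matrix is one of: (D8)–(D9), (E1)–(E2) with $m_1=m_2+1$, (E3) with $m_1=m_2+1$ and $-\nu\in(F_p^* )^2$, (E4) with $m_1=m_2+1$ and $-r\in(F_p^* )^2$, (E5)–(E6) with $m_1=m_2+1$, (E8)–(E13), (F2)–(F3). (6) If $I_{\max}=m_1$, then the characteristic matrix is one of: (D1)–(D7), (E1)–(E2) with $m_1>m_2+1$, (E3) with $m_1>m_2+1$ or $-\nu\notin(F_p^* )^2$, (E4) with $m_1>m_2+1$ or $-r\notin(F_p^* )^2$, (E5)–(E6) with $m_1>m_2+1$, (E7).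
   Context: $d(G)$ is the minimal number of generators, $\Phi(G)$ the Frattini subgroup, $G'$ the derived subgroup, $C_p^3$ elementary abelian of order $p^3$, $F_p$ the field with $p$ elements, $F_p^*$ its multiplicative group and $(F_p^* )^2=\{a^2:a\in F_p^*\}$. An $\mathcal{A}_1$-group is a minimal non-abelian group (non-abelian with all proper subgroups abelian). $p^{I_{\min}}$ and $p^{I_{\max}}$ denote respectively the minimal and the maximal index in $G$ of $\mathcal{A}_1$-subgroups of $G$. Characteristic matrix: let $G/G'$ have type $(p^{m_1},p^{m_2},p^{m_3})$, $m_1\ge m_2\ge m_3\ge1$ (i.e. $G/G'\cong C_{p^{m_1}}\times C_{p^{m_2}}\times C_{p^{m_3}}$). Choose $a_1,a_2,a_3\in G$ with $G/G'=\langle a_1G'\rangle\times\langle a_2G'\rangle\times\langle a_3G'\rangle$, $o(a_iG')=p^{m_i}$; put $x=[a_2,a_3]$, $y=[a_3,a_1]$, $z=[a_1,a_2]$, so $G'=\langle x,y,z\rangle$, and write $a_i^{p^{m_i}}=x^{w_{i1}}y^{w_{i2}}z^{w_{i3}}$. The matrix $w(G)=(w_{ij})$ over $F_p$ is called a characteristic matrix of $G$; together with $p,m_1,m_2,m_3$ it determines $G$ up to isomorphism. Let $e_{ij}$ (two indices) be the $3\times3$ matrix over $F_p$ with $1$ at $(i,j)$ and $0$ elsewhere; $\eta$ a fixed square non-residue modulo odd $p$; $\nu\in\{1,\eta\}$ (equal to $1$ if $p=2$); $t\in F_p$, $t\neq0$; $r\in\{1,\dots,p-2\}$. The list is: For odd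 $p$: (D1) $e_{11}+e_{23}-e_{32}$; (D2) $e_{11}+\nu e_{22}+e_{23}-e_{32}$; (D3) $e_{11}+e_{22}+\nu e_{33}$; (D4) $e_{11}+e_{22}+e_{23}-e_{32}+re_{33}$; (E1) $e_{23}-e_{32}$; (E2) $e_{22}+e_{23}-e_{32}$; (E3) $e_{22}+\nu e_{33}$; (E4) $e_{22}+e_{23}-e_{32}+re_{33}$. For $p=2$: (D5) $e_{11}+e_{23}+e_{32}$; (D6) $e_{11}+e_{22}+e_{33}$; (D7) $e_{11}+e_{22}+e_{32}+e_{33}$; (E5) $e_{23}+e_{32}$; (E6) $e_{22}+e_{33}$; (E7) $e_{22}+e_{32}+e_{33}$. For all $p$: (D8) $e_{13}+e_{22}+te_{31}$; (D9) $e_{13}+e_{21}+e_{32}$; (E8) $e_{11}+e_{23}$; (E9) $e_{11}+\nu e_{33}$; (E10) $e_{23}+e_{31}$; (E11) $e_{21}+e_{33}$; (E12) $e_{13}+e_{22}$; (E13) $e_{13}+e_{32}$; (E14) $e_{13}+e_{21}$; (E15) $e_{13}+te_{31}$; (F1) $e_{11}$; (F2) $e_{23}$; (F3) $e_{33}$; (F4) $e_{21}$; (F5) $0$; (F6) $e_{13}$. *)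

(* Defs.v *)
From mathcomp Require Export all_boot all_order all_algebra all_fingroup all_solvable.

Set Implicit Arguments.
Unset Strict Implicit.
Unset Printing Implicit Defensive.

Import GroupScope GRing.Theory.

Definition minimal_nonabelian (gT : finGroupType) (H : {group gT}) : Prop :=
  ~~ abelian H /\ forall K : {group gT}, K \proper H -> abelian K.

Definition A1_subgroup (gT : finGroupType) (G H : {group gT}) : Prop :=
  H \subset G /\ minimal_nonabelian H.

Definition is_Imin (gT : finGroupType) (p : nat) (G : {group gT}) (I : nat) : Prop :=
  (exists H : {group gT}, A1_subgroup G H /\ #|G : H| = (p ^ I)%N) /\
  (forall H : {group gT}, A1_subgroup G H -> (p ^ I <= #|G : H|)%N).

Definition is_Imax (gT : finGroupType) (p : nat) (G : {group gT}) (I : nat) : Prop :=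
  (exists H : {group gT}, A1_subgroup G H /\ #|G : H| = (p ^ I)%N) /\
  (forall H : {group gT}, A1_subgroup G H -> (#|G : H| <= p ^ I)%N).

(* 1-based matrix indices: [ix 1], [ix 2], [ix 3]. *)
Definition ix (k : nat) : 'I_3 := inord k.-1.

(* The exponents below are the canonical representatives in [0, p) of the
   entries of w. *)
Definition is_characteristic_matrix (gT : finGroupType) (p m1 m2 m3 : nat)
    (G : {group gT}) (w : 'M['F_p]_3) : Prop :=
  exists a1 a2 a3 : gT,
    [/\ a1 \in G, a2 \in G & a3 \in G] /\
    <[coset G^`(1) a1]> \x <[coset G^`(1) a2]> \x <[coset G^`(1) a3]>
      = G / G^`(1) /\
    [/\ #[coset G^`(1) a1] = (p ^ m1)%N,
        #[coset G^`(1) a2] = (p ^ m2)%N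
      & #[coset G^`(1) a3] = (p ^ m3)%N] /\
    let x := [~ a2, a3] in
    let y := [~ a3, a1] in
    let z := [~ a1, a2] in
    let word (i : 'I_3) :=
      x ^+ w i (ix 1) * y ^+ w i (ix 2) * z ^+ w i (ix 3) in
    [/\ a1 ^+ (p ^ m1) = word (ix 1),
        a2 ^+ (p ^ m2) = word (ix 2)
      & a3 ^+ (p ^ m3) = word (ix 3)].

Definition Fp_star_sq (p : nat) (c : 'F_p) : Prop :=
  exists a : 'F_p, a != 0%R /\ c = (a ^+ 2)%R.

Definition square_nonresidue (p : nat) (c : 'F_p) : Prop :=
  c != 0%R /\ ~ Fp_star_sq c.

(* Entries of the list of matrices; the argument, when there is one, is the
   parameter nu (D2, D3, E3, E9), t (D8, E15) or r (D4, E4). *)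
Inductive matrix_name (p : nat) : Type :=
| D1 | D2 of 'F_p | D3 of 'F_p | D4 of nat | D5 | D6 | D7 | D8 of 'F_p | D9
| E1 | E2 | E3 of 'F_p | E4 of nat | E5 | E6 | E7 | E8 | E9 of 'F_p | E10
| E11 | E12 | E13 | E14 | E15 of 'F_p
| F1 | F2 | F3 | F4 | F5 | F6.

Definition admissible (p : nat) (eta : 'F_p) (c : matrix_name p) : Prop :=
  let nu_ok (nu : 'F_p) := nu = 1%R \/ odd p /\ nu = eta in
  match c with
  | D1 | E1 | E2 => odd p
  | D2 nu | D3 nu | E3 nu => odd p /\ nu_ok nu
  | D4 r | E4 r => odd p /\ (1 <= r <= p - 2)%N
  | D5 | D6 | D7 | E5 | E6 | E7 => p = 2
  | D8 t | E15 t => t != 0%R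
  | E9 nu => nu_ok nu
  | _ => True
  end.

Definition e (p i j : nat) : 'M['F_p]_3 := delta_mx (ix i) (ix j).

Definition named_matrix (p : nat) (c : matrix_name p) : 'M['F_p]_3 :=
  (match c with
  | D1 => e p 1 1 + e p 2 3 - e p 3 2
  | D2 nu => e p 1 1 + nu *: e p 2 2 + e p 2 3 - e p 3 2
  | D3 nu => e p 1 1 + e p 2 2 + nu *: e p 3 3
  | D4 r => e p 1 1 + e p 2 2 + e p 2 3 - e p 3 2 + r%:R *: e p 3 3
  | D5 => e p 1 1 + e p 2 3 + e p 3 2
  | D6 => e p 1 1 + e p 2 2 + e p 3 3
  | D7 => e p 1 1 + e p 2 2 + e p 3 2 + e p 3 3
  | D8 t => e p 1 3 + e p 2 2 + t *: e p 3 1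
  | D9 => e p 1 3 + e p 2 1 + e p 3 2
  | E1 => e p 2 3 - e p 3 2
  | E2 => e p 2 2 + e p 2 3 - e p 3 2
  | E3 nu => e p 2 2 + nu *: e p 3 3
  | E4 r => e p 2 2 + e p 2 3 - e p 3 2 + r%:R *: e p 3 3
  | E5 => e p 2 3 + e p 3 2
  | E6 => e p 2 2 + e p 3 3
  | E7 => e p 2 2 + e p 3 2 + e p 3 3
  | E8 => e p 1 1 + e p 2 3
  | E9 nu => e p 1 1 + nu *: e p 3 3
  | E10 => e p 2 3 + e p 3 1
  | E11 => e p 2 1 + e p 3 3
  | E12 => e p 1 3 + e p 2 2
  | E13 => e p 1 3 + e p 3 2
  | E14 => e p 1 3 + e p 2 1
  | E15 t => e p 1 3 + t *: e p 3 1
  | F1 => e p 1 1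
  | F2 => e p 2 3
  | F3 => e p 3 3
  | F4 => e p 2 1
  | F5 => 0
  | F6 => e p 1 3
  end)%R.

(* Main.v *)
(* Since Phi(G) is central, the A1-subgroups of G are the groups H = <g, h>
   generated by two non-commuting elements, and in the basis x, y, z of G' the
   commutator [g, h] is the cross product of the exponent vectors of g and h. If g and h have orders p^a and p^b modulo G' and are
   independent modulo G', then the intersection N of H with G' is generated by
   g^(p^a), h^(p^b) and [g, h], so |G : H| is |G| / (p^(a+b) |N|), and |N| = p^r
   where r is the rank of a 3 x 3 matrix over F_p read off from w. Replacing h by
   h g^k one may assume that either h involves no a1, or that the exponents of a1
   in g and in h are both divisible by p^(m1 - m2). This expresses all the indices
   through ranks, and the six claims become statements about the vanishing of
   minors of explicit matrices. *)

Require Import Defs.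
From mathcomp Require Import mxabelem.
From mathcomp Require Import ring zify.
Import GroupScope GRing.Theory.

Set Implicit Arguments.
Unset Strict Implicit.
Unset Printing Implicit Defensive.

(** The threshold p^(m1 - m2) is where the a1-part of an element stops having larger order modulo G'
    than the a2- and a3-parts. Below it, the power p^(m1 - v) of g kills the other parts and only
    the first row of w survives; from it on, all three rows mix. Both cases rest on the p^k-th power
    map being multiplicative for k >= m2, which is where m2 > 1 for p = 2 is used. The exponent of
    the index is m2 + v + 3 - r with v < m1 - m2 in the first case, and m1 + 3 - r in the second,
    with 1 <= r <= 3. So I_min = m2 asks for a nonzero determinant with v = 0, and I_max = m1 + 2
    for rank 1 in the second case. The delicate value is m1 + 1: it comes from rank 2 in the second
    case or from rank 1 with v = m1 - m2 - 1. When w12 = w13 = 0 and the lower right 2 x 2 block of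
    w is invertible, only the latter is left and it forces v = 0, hence m1 = m2 + 1. Rank 1 then
    makes (k, l) an isotropic vector of a binary quadratic form, which is why -nu and -r have to be
    squares. *)

Definition mx3 (R : Type) (u v w : 'rV[R]_3) : 'M[R]_3 :=
  \matrix_(i < 3) (if i == 0%R then u else if i == 1%R then v else w).

Lemma row_mx3 (R : Type) (u v w : 'rV[R]_3) :
  [/\ row 0%R (mx3 u v w) = u, row 1%R (mx3 u v w) = v
    & row 2%R (mx3 u v w) = w].
Proof. by split; rewrite rowK. Qed.

Lemma sum3 (V : zmodType) (F : 'I_3 -> V) :
  (\sum_i F i = F 0 + F 1 + F 2)%R.
Proof.
rewrite !big_ord_recl big_ord0 addr0 addrA.
by congr (F _ + F _ + F _)%R; apply: val_inj.
Qed.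

Lemma sub_mx3 (F : fieldType) (u v w a : 'rV[F]_3) :
  reflect (exists k l m : F, a = k *: u + l *: v + m *: w)%R
          (a <= mx3 u v w)%MS.
Proof.
have [r0 r1 r2] := row_mx3 u v w.
apply: (iffP submxP) => [[D ->]|[k [l [m ->]]]].
  exists (D 0%R 0%R), (D 0%R 1%R), (D 0%R 2%R).
  by rewrite mulmx_sum_row sum3 r0 r1 r2.
exists (\row_(i < 3) (if i == 0 then k else if i == 1 then l else m))%R.
by rewrite mulmx_sum_row sum3 r0 r1 r2 !mxE.
Qed.

(** * Words in three commuting elements of exponent p, as vectors over F_p *)

Section Pow3.
Variables (p : nat) (gT : finGroupType).
Hypothesis p_pr : prime p.

Lemma expg_Fp_nat (x : gT) n : x ^+ p = 1 -> x ^+ (n%:R : 'F_p)%R = x ^+ n.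
Proof. by move=> xp; rewrite val_Fp_nat // expg_mod. Qed.

Lemma expg_FpD (x : gT) (a b : 'F_p) :
  x ^+ p = 1 -> x ^+ (a + b)%R = x ^+ a * x ^+ b.
Proof.
move=> xp; rewrite -expgD -(expg_Fp_nat (a + b) xp) natrD.
by rewrite !natr_Zp.
Qed.

Definition pow3 (x y z : gT) (v : 'rV['F_p]_3) : gT :=
  x ^+ v 0%R 0%R * y ^+ v 0%R 1%R * z ^+ v 0%R 2%R.

Variables x y z : gT.
Hypotheses (xp : x ^+ p = 1) (yp : y ^+ p = 1) (zp : z ^+ p = 1).
Hypotheses (cxy : commute x y) (cxz : commute x z) (cyz : commute y z).

(** The source is the additive group of row vectors, so [u * v] inside [pow3] is vector addition. *)
Lemma pow3M : {in [set: 'rV['F_p]_3] &, {morph pow3 x y z : u v / u * v}}.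
Proof.
move=> u v _ _; rewrite /pow3 !mxE !expg_FpD // !mulgA.
congr (_ * _); rewrite -!mulgA; congr (_ * _); rewrite !mulgA.
have c1 : commute (x ^+ v 0%R 0%R) (y ^+ u 0%R 1%R) by apply: commuteX2.
have c2 : commute (x ^+ v 0%R 0%R) (z ^+ u 0%R 2%R) by apply: commuteX2.
have c3 : commute (y ^+ v 0%R 1%R) (z ^+ u 0%R 2%R) by apply: commuteX2.
by rewrite c1 -!mulgA c3 [in LHS](mulgA (x ^+ _) (z ^+ _)) c2 !mulgA.
Qed.

Canonical pow3_morphism := Morphism pow3M.

Local Notation phi := (pow3 x y z).

Lemma pow3Z (k : 'F_p) v : phi (k *: v)%R = phi v ^+ k.
Proof.
rewrite -[k in LHS]natr_Zp; elim: (k : nat) => [|n IHn].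
  by rewrite scale0r /pow3 !mxE !expg0 !mulg1.
by rewrite -natr1 scalerDl scale1r pow3M ?in_setT // IHn expgSr.
Qed.

Lemma pow3_gen (u v w : 'rV['F_p]_3) :
  phi @: rowg (mx3 u v w) = <<[set phi u; phi v; phi w]>>.
Proof.
have phiD a b : phi (a + b)%R = phi a * phi b by apply: pow3M; rewrite inE.
apply/eqP; rewrite eqEsubset; apply/andP; split.
  apply/subsetP => _ /imsetP[a + ->]; rewrite inE => /sub_mx3[k [l [m ->]]].
  by rewrite !phiD !pow3Z !groupM ?groupX ?mem_gen // !inE eqxx ?orbT.
have phiG : group_set (phi @: rowg (mx3 u v w)).
  have -> : phi @: rowg (mx3 u v w) = pow3_morphism @* rowg (mx3 u v w).
    by rewrite morphimEsub ?subsetT.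
  exact: groupP.
rewrite (gen_subG _ (Group phiG)) /=; apply/subsetP => a.
have [r0 r1 r2] := row_mx3 u v w.
rewrite !inE => /orP[/orP[]|] /eqP->; apply: imset_f; rewrite mem_rowg.
- by rewrite -[X in (X <= _)%MS]r0 row_sub.
- by rewrite -[X in (X <= _)%MS]r1 row_sub.
- by rewrite -[X in (X <= _)%MS]r2 row_sub.
Qed.

(** This is the passage from the order of the intersection with G' to a rank. *)
Lemma card_pow3_gen (u v w : 'rV['F_p]_3) :
  injective phi ->
  #|<<[set phi u; phi v; phi w]>>| = (p ^ \rank (mx3 u v w))%N.
Proof. by move=> inj; rewrite -pow3_gen card_imset // card_rowg card_Fp. Qed.

(** Counting: the image contains a group of order p^3, which is also the size of the source. *)
Lemma pow3_inj : #|<<[set x; y; z]>>| = (p ^ 3)%N -> injective phi.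
Proof.
move=> cardG.
have gE : <<[set x; y; z]>> \subset phi @: setT.
  have phiG : group_set (phi @: setT).
    have -> : phi @: setT = pow3_morphism @* setT by rewrite morphimEdom.
    exact: groupP.
  rewrite (gen_subG _ (Group phiG)) /=; apply/subsetP => a.
  have one_p : (1%R : 'F_p) = 1%N :> nat by [].
  rewrite !inE => /orP[/orP[]|] /eqP->; apply/imsetP;
    [exists (delta_mx 0 0)%R|exists (delta_mx 0 1)%R|exists (delta_mx 0 2)%R];
    by rewrite ?in_setT // /pow3 !mxE /= ?expg1 ?expg0 ?mulg1 ?mul1g.
have/imset_injP inj : #|phi @: setT| == #|[set: 'rV['F_p]_3]|.
  rewrite eqn_leq leq_imset_card /= cardsT card_mx card_Fp // mul1n -cardG.
  exact: subset_leq_card.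
by move=> u v; apply: inj; rewrite in_setT.
Qed.

End Pow3.

(** * Cross products, determinants and ranks of three rows *)

Section Rows.
Variable F : fieldType.
Implicit Types u v w : 'rV[F]_3.
Local Open Scope ring_scope.

Definition row3 (a b c : F) : 'rV[F]_3 :=
  \row_(j < 3) (if j == 0 then a else if j == 1 then b else c).

Lemma row3E a b c :
  (row3 a b c 0 0 = a) * (row3 a b c 0 1 = b) * (row3 a b c 0 2 = c).
Proof. by rewrite !mxE. Qed.

Lemma ord3P (P : 'I_3 -> Prop) : P 0 -> P 1 -> P 2 -> forall i, P i.
Proof.
move=> P0 P1 P2 i.
case: (unliftP 0 i) => [j ->|-> //]; case: (unliftP 0 j) => [k ->|->].
  by rewrite (ord1 k); have -> : lift 0 (lift 0 (0 : 'I_1)) = 2 :> 'I_3 by exact: val_inj.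
by have -> : lift 0 (0 : 'I_2) = 1 :> 'I_3 by exact: val_inj.
Qed.

Lemma row3P u v :
  u 0 0 = v 0 0 -> u 0 1 = v 0 1 -> u 0 2 = v 0 2 -> u = v.
Proof. by move=> *; apply/rowP; apply: ord3P. Qed.

Lemma row3_0 : row3 0 0 0 = 0.
Proof. by apply: row3P; rewrite !mxE. Qed.

Lemma row3_eq0 a b c : (row3 a b c == 0) = [&& a == 0, b == 0 & c == 0].
Proof.
apply/eqP/and3P => [/rowP r0|[/eqP-> /eqP-> /eqP->]]; last exact: row3_0.
by move: (r0 0) (r0 1) (r0 2); rewrite !row3E !mxE => -> -> ->; rewrite eqxx.
Qed.

Definition cross u v : 'rV[F]_3 :=
  row3 (u 0 1 * v 0 2 - u 0 2 * v 0 1) (u 0 2 * v 0 0 - u 0 0 * v 0 2)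
       (u 0 0 * v 0 1 - u 0 1 * v 0 0).

(** The left side is the bilinear expansion of [[~ g, h]] with x, y, z read as e1, e2, e3; the signs
    come from [a1, a3] = y^-1, [a2, a1] = z^-1 and [a3, a2] = x^-1. *)
Lemma cross_expand (i1 i2 i3 j1 j2 j3 : F) :
  let e1 := row3 1 0 0 in let e2 := row3 0 1 0 in let e3 := row3 0 0 1 in
  i1 *: (j2 *: e3 + j3 *: - e2) + i2 *: (j1 *: - e3 + j3 *: e1)
    + i3 *: (j1 *: e2 + j2 *: - e1) = cross (row3 i1 i2 i3) (row3 j1 j2 j3).
Proof. by apply: row3P; rewrite /cross !mxE /=; ring. Qed.

Definition det3 u v w :=
  u 0 0 * (v 0 1 * w 0 2 - v 0 2 * w 0 1)
  - u 0 1 * (v 0 0 * w 0 2 - v 0 2 * w 0 0)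
  + u 0 2 * (v 0 0 * w 0 1 - v 0 1 * w 0 0).

(** The three determinants with a unit vector decide when a1, a2 or a3 completes g, h to a
    generating set of [G]. *)
Lemma det3_e1 (i1 i2 i3 j1 j2 j3 : F) :
  det3 (row3 i1 i2 i3) (row3 j1 j2 j3) (row3 1 0 0) = i2 * j3 - i3 * j2.
Proof. by rewrite /det3 !row3E; ring. Qed.

Lemma det3_e2 (i1 i2 i3 k l : F) :
  det3 (row3 i1 i2 i3) (row3 0 k l) (row3 0 1 0) = - (i1 * l).
Proof. by rewrite /det3 !row3E; ring. Qed.

Lemma det3_e3 (i1 i2 i3 k l : F) :
  det3 (row3 i1 i2 i3) (row3 0 k l) (row3 0 0 1) = i1 * k.
Proof. by rewrite /det3 !row3E; ring. Qed.

Lemma cross_row3 (i1 i2 i3 j1 j2 j3 : F) :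
  cross (row3 i1 i2 i3) (row3 j1 j2 j3) =
    row3 (i2 * j3 - i3 * j2) (i3 * j1 - i1 * j3) (i1 * j2 - i2 * j1).
Proof. by rewrite /cross !row3E. Qed.

Lemma det_mx3 u v w : \det (mx3 u v w) = det3 u v w.
Proof.
have l0 : lift 0 (0 : 'I_2) = 1 :> 'I_3 by exact: val_inj.
have l1 : lift 0 (1 : 'I_2) = 2 :> 'I_3 by exact: val_inj.
have l2 : lift 1 (0 : 'I_2) = 0 :> 'I_3 by exact: val_inj.
have l3 : lift 1 (1 : 'I_2) = 2 :> 'I_3 by exact: val_inj.
have l4 : lift 2 (0 : 'I_2) = 0 :> 'I_3 by exact: val_inj.
have l5 : lift 2 (1 : 'I_2) = 1 :> 'I_3 by exact: val_inj.
have d2 (A : 'M[F]_2) : \det A = A 0 0 * A 1 1 - A 0 1 * A 1 0.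
  rewrite (expand_det_row _ 0) !big_ord_recl big_ord0 addr0 /cofactor !det_mx11.
  have k0 : lift 0 (0 : 'I_1) = 1 :> 'I_2 by exact: val_inj.
  have k1 : lift 1 (0 : 'I_1) = 0 :> 'I_2 by exact: val_inj.
  by rewrite !mxE /= !k0 !k1 /=; ring.
rewrite (expand_det_row _ 0) sum3 /cofactor !d2 !mxE /= ?l0 ?l1 ?l2 ?l3 ?l4 ?l5.
by rewrite /det3 /=; ring.
Qed.

Lemma rank_mx3_full u v w : (\rank (mx3 u v w) == 3%N) = (det3 u v w != 0).
Proof. by rewrite -unitfE -det_mx3 -unitmxE -row_free_unit. Qed.

Lemma rank_mx3_le3 u v w : (\rank (mx3 u v w) <= 3)%N.
Proof. exact: rank_leq_row. Qed.

Lemma rank_mx3_le1 u v w : w != 0 -> (\rank (mx3 u v w) <= 1)%N ->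
  exists k l, u = k *: w /\ v = l *: w.
Proof.
move=> wn0 rk; have [r0 r1 r2] := row_mx3 u v w.
have sw : (w <= mx3 u v w)%MS by rewrite -[X in (X <= _)%MS]r2 row_sub.
have sM : (mx3 u v w <= w)%MS.
  by rewrite -(geq_leqif (mxrank_leqif_sup sw)) rank_rV wn0.
have /sub_rVP[k ku] : (u <= w)%MS.
  by apply: submx_trans sM; rewrite -[X in (X <= _)%MS]r0 row_sub.
have /sub_rVP[l lv] : (v <= w)%MS.
  by apply: submx_trans sM; rewrite -[X in (X <= _)%MS]r1 row_sub.
by exists k, l.
Qed.

Lemma rank_mx3_mul u v w k l : u = k *: w -> v = l *: w ->
  (\rank (mx3 u v w) <= 1)%N.
Proof.
move=> -> ->; have : (mx3 (k *: w) (l *: w) w <= w)%MS.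
  apply/row_subP; have [r0 r1 r2] := row_mx3 (k *: w) (l *: w) w.
  by apply: ord3P; rewrite ?r0 ?r1 ?r2 // scalemx_sub.
by move/mxrankS/leq_trans; apply; apply: rank_leq_row.
Qed.

Lemma rank_mx3_gt0 u v w : w != 0 -> (0 < \rank (mx3 u v w))%N.
Proof.
move=> wn0; have [r0 r1 r2] := row_mx3 u v w.
rewrite lt0n mxrank_eq0; apply: contra wn0 => /eqP M0.
by rewrite -r2 M0 linear0.
Qed.

Variables (m n : nat) (W1 W2 W3 : 'rV[F]_3) (idx : nat -> Prop).

(* [idx i] means that some A1-subgroup <g, h> has index p^i, and W1, W2, W3 are
   the rows of w. In the first alternative v < m - n is the p-adic valuation
   of the exponent of a1 in g, and h involves no a1; in the second one the
   exponents of a1 in g and h are both divisible by p^(m - n). The rows under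
   \rank span the intersection of <g, h> with G'. *)
Definition index_forms : Prop := forall i, idx i ->
  (exists (v : nat) (a b c k l : F),
    let t := cross (row3 (if v == 0%N then a else 0) b c) (row3 0 k l) in
    [/\ (v < m - n)%N, a != 0, t != 0 &
      (i + \rank (mx3 (a *: W1) (k *: W2 + l *: W3) t) = n + v + 3)%N]) \/
  (exists i1 i2 i3 j1 j2 j3 : F,
    (i2 * j3 - i3 * j2 != 0) /\
    (i + \rank (mx3 (i1 *: W1 + i2 *: W2 + i3 *: W3)
                    (j1 *: W1 + j2 *: W2 + j3 *: W3)
                    (row3 (i2 * j3 - i3 * j2) 0 0)) = m + 3)%N).

(** The case v = 0 with g = a1 a2^b a3^c and h = a2^k a3^l. The commutator is (bl - ck, -l, k), and
    its first entry s is free because b and c are. *)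
Definition low_index_ex : Prop := forall s k l : F, (k != 0) || (l != 0) ->
  exists2 i, idx i &
    (i + \rank (mx3 W1 (k *: W2 + l *: W3) (row3 s (- l) k)) = n + 3)%N.

(** Here g is a2 and h is a3, each multiplied by a power of a1^(p^(m - n)), so that the commutator
    is x. *)
Definition high_index_ex : Prop := forall i j : F,
  exists2 d, idx d &
    (d + \rank (mx3 (i *: W1 + W2) (j *: W1 + W3) (row3 1 0 0)) = m + 3)%N.

End Rows.

(** * The index of a two-generator subgroup *)

Lemma card_gen2_commute (gT : finGroupType) (a b : gT) :
  commute a b -> (#|<<[set a; b]>>| <= #[a] * #[b])%N.
Proof.
move=> cab; have <- : <[a]> <*> <[b]> = <<[set a; b]>>.
  by rewrite joing_idl joing_idr.
rewrite cent_joinEr ?cent_cycle ?cycle_subG; last by apply/cent1P.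
by rewrite mul_cardG leq_pmulr // cardG_gt0.
Qed.

Lemma order_le_expg1 (gT : finGroupType) (x : gT) n :
  (0 < n)%N -> x ^+ n = 1 -> (#[x] <= n)%N.
Proof. by move=> n0 xn; rewrite dvdn_leq // order_dvdn xn. Qed.

(* The quotients by N and by G' bound #|H| from above and from below; the
   hypothesis on #|G| makes the two bounds coincide. *)
Lemma index_gen2 (gT : finGroupType) (G N : {group gT}) (a b d : gT)
    (A B D : nat) :
  (0 < A)%N -> (0 < B)%N -> (0 < D)%N ->
  <<[set a; b; d]>> = G -> N \subset 'Z(G) ->
  N \subset <<[set a; b]>> -> N \subset G^`(1) -> [~ a, b] \in N ->
  a ^+ A \in N -> b ^+ B \in N -> d ^+ D \in <<[set a; b]>> <*> G^`(1) ->
  #|G| = (A * B * D * #|G^`(1)|)%N ->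
  (#|G : <<[set a; b]>>| * #|N| = D * #|G^`(1)|)%N.
Proof.
move=> A0 B0 D0 genG NZ NH NG' abN aA bB dD cardG.
have [aG bG dG] : [/\ a \in G, b \in G & d \in G].
  by rewrite -genG; split; apply: mem_gen; rewrite !inE eqxx ?orbT.
set H := <<[set a; b]>>%G; rewrite -/(gval H) in NH dD *.
have HG : H \subset G by rewrite gen_subG; apply/subsetP=> g /set2P[]->.
have nNG : G \subset 'N(N).
  by rewrite cents_norm // centsC (subset_trans NZ) ?subsetIr.
have leH : (#|H| <= A * B * #|N|)%N.
  rewrite -(Lagrange NH) mulnC leq_mul2r; apply/orP; right.
  rewrite -card_quotient ?(subset_trans HG) // quotient_gen; last first.
    by rewrite (subset_trans _ nNG) // -gen_subG.
  have nNa := subsetP nNG _ aG; have nNb := subsetP nNG _ bG.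
  have -> : [set a; b] / N = [set coset N a; coset N b].
    by rewrite /quotient morphimU !morphim_set1.
  apply: leq_trans (card_gen2_commute _) _.
    by apply/commgP; rewrite -morphR //= coset_id.
  by apply: leq_mul; apply: order_le_expg1 => //; rewrite -morphX //= coset_id.
set K := (H <*> G^`(1))%G.
have HK : H \subset K by exact: joing_subl.
have sG'G := der_sub 1 G.
have KG : K \subset G by rewrite join_subG HG.
have nK : K <| G by rewrite sub_der1_normal // joing_subr.
have nKG := normal_norm nK.
have leD : (#|G : K| <= D)%N.
  rewrite -card_quotient // -[in X in (#|X| <= _)%N]genG quotient_gen ?genG; last first.
    by rewrite (subset_trans _ nKG) // -gen_subG genG.
  suff: (#|<[coset K d]>| <= D)%N.
    apply: leq_trans; apply: subset_leq_card; rewrite gen_subG /=.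
    have in_ker h : h \in [set a; b] -> coset K h = 1.
      by move=> hab; apply: coset_id; rewrite (subsetP HK) // mem_gen.
    apply/subsetP => _ /morphimP[g _ + ->]; rewrite inE => /orP[/in_ker|/set1P->] /=.
      by move->; exact: group1.
    exact: cycle_id.
  apply: order_le_expg1 => //.
  by rewrite -morphX ?(subsetP nKG) //= coset_id.
have cardK : (#|K| * #|H :&: G^`(1)| = #|H| * #|G^`(1)|)%N.
  rewrite /K /= norm_joinEl ?mul_cardG //.
  by rewrite (subset_trans HG) // gFnorm.
have leN : (#|N| <= #|H :&: G^`(1)|)%N by rewrite subset_leq_card // subsetI NH.
have geH : (A * B * #|N| <= #|H|)%N.
  rewrite -(leq_pmul2r (_ : 0 < D * #|G^`(1)|)%N) ?muln_gt0 ?D0 ?cardG_gt0 //.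
  have -> : (A * B * #|N| * (D * #|G^`(1)|) = #|G| * #|N|)%N.
    by rewrite cardG; ring.
  rewrite -(Lagrange KG); apply: (@leq_trans (#|K| * D * #|H :&: G^`(1)|)%N).
    by rewrite !leq_mul.
  by rewrite mulnAC cardK -mulnA [(_ * D)%N]mulnC.
have eqH : #|H| = (A * B * #|N|)%N by apply/eqP; rewrite eqn_leq leH.
apply/eqP; rewrite -(eqn_pmul2l (_ : 0 < A * B)%N) ?muln_gt0 ?A0 //.
by rewrite mulnCA -eqH mulnC Lagrange // cardG !mulnA.
Qed.

(** For odd p the factor 2 in 2 C(p^k, 2) = p^k (p^k - 1) can be cancelled; for p = 2 it costs one
    power of 2, and C(2, 2) = 1 shows that k = 1 fails. *)
Lemma dvdn_bin_pexp2 (p k : nat) :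
  prime p -> (0 < k)%N -> (p = 2 -> (1 < k)%N) -> p %| 'C(p ^ k, 2).
Proof.
move=> p_pr k0 k2; have := mul_bin_diag (p ^ k) 1; rewrite bin1 => E.
have [p2|pn2] := eqVneq p 2.
  have k1 := k2 p2; rewrite -(@dvdn_pmul2l 2) // -E p2.
  by rewrite dvdn_mulr // (@dvdn_exp2l 2 2).
have : p %| 2 * 'C(p ^ k, 2) by rewrite -E dvdn_mulr // dvdn_exp.
by rewrite Euclid_dvdM // dvdn_prime2 // (negPf pn2).
Qed.

Definition A1_exponent (gT : finGroupType) (p : nat) (G : {group gT}) (i : nat) :=
  exists2 H : {group gT}, A1_subgroup G H & #|G : H| = (p ^ i)%N.

(** * The group G, with m = m1 and n = m2 = m3: central commutators and powers *)

Section Setup.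
Variables (gT : finGroupType) (G : {group gT}) (p m n : nat) (a1 a2 a3 : gT).
Variable w : 'M['F_p]_3.
Hypotheses (p_pr : prime p) (pG : p.-group G) (PhiZ : 'Phi(G) \subset 'Z(G)).
Hypotheses (abelG' : p.-abelem G^`(1)) (cardG' : #|G^`(1)| = (p ^ 3)%N).
Hypotheses (n_gt0 : (0 < n)%N) (n_lt_m : (n < m)%N) (n_gt1 : p = 2 -> (1 < n)%N).
Hypotheses (a1G : a1 \in G) (a2G : a2 \in G) (a3G : a3 \in G).
Hypothesis dprodG : <[coset G^`(1) a1]> \x <[coset G^`(1) a2]> \x <[coset G^`(1) a3]>
  = G / G^`(1).
Hypotheses (o1 : #[coset G^`(1) a1] = (p ^ m)%N)
  (o2 : #[coset G^`(1) a2] = (p ^ n)%N) (o3 : #[coset G^`(1) a3] = (p ^ n)%N).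
Local Notation x := [~ a2, a3].
Local Notation y := [~ a3, a1].
Local Notation z := [~ a1, a2].
Local Notation phi := (@pow3 p gT x y z).
Hypotheses (pw1 : a1 ^+ (p ^ m) = phi (row 0%R w))
  (pw2 : a2 ^+ (p ^ n) = phi (row 1%R w)) (pw3 : a3 ^+ (p ^ n) = phi (row 2%R w)).

Let p_gt0 : (0 < p)%N := prime_gt0 p_pr.

Lemma der_sub_Phi : G^`(1) \subset 'Phi(G).
Proof. by rewrite (Phi_joing pG) joing_subl. Qed.

Lemma der_central c : c \in G^`(1) -> forall g, g \in G -> commute c g.
Proof.
move=> /(subsetP der_sub_Phi)/(subsetP PhiZ)/centerP[_ cZ] g gG.
exact: cZ.
Qed.

Lemma memRG g h : g \in G -> h \in G -> [~ g, h] \in G^`(1).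
Proof. exact: mem_commg. Qed.

Lemma der_expp c : c \in G^`(1) -> c ^+ p = 1.
Proof. by move/(abelemP p_pr): abelG' => [_]; apply. Qed.

Lemma derG g : g \in G^`(1) -> g \in G.
Proof. exact: (subsetP (der_sub 1 G)). Qed.

Lemma der_commute c d : c \in G^`(1) -> d \in G^`(1) -> commute c d.
Proof. by move=> cG' /derG; apply: der_central. Qed.

Lemma expp_Phi g : g \in G -> g ^+ p \in 'Phi(G).
Proof.
move=> gG; rewrite (Phi_joing pG) (subsetP (joing_subr _ _)) //.
by have := Mho_p_elt 1 gG (mem_p_elt pG gG); rewrite expn1.
Qed.

Lemma commMl g h k : g \in G -> h \in G -> k \in G ->
  [~ g * h, k] = [~ g, k] * [~ h, k].
Proof.
move=> gG hG kG; rewrite commMgJ conjgE; congr (_ * _).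
by rewrite (der_central (memRG gG kG)) // mulKg.
Qed.

Lemma commMr g h k : g \in G -> h \in G -> k \in G ->
  [~ k, g * h] = [~ k, g] * [~ k, h].
Proof.
move=> gG hG kG; rewrite commgMJ conjgE (der_central (memRG kG gG)) // mulKg.
exact: der_commute (memRG _ _) (memRG _ _).
Qed.

Lemma commXl g k i : g \in G -> k \in G -> [~ g ^+ i, k] = [~ g, k] ^+ i.
Proof.
by move=> gG kG; rewrite commXg //; apply/commute_sym/der_central/gG/memRG.
Qed.

Lemma commXr g k i : g \in G -> k \in G -> [~ k, g ^+ i] = [~ k, g] ^+ i.
Proof.
by move=> gG kG; rewrite commgX //; apply/commute_sym/der_central/gG/memRG.
Qed.

Lemma commDl c k : c \in G^`(1) -> k \in G -> [~ c, k] = 1.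
Proof. by move=> cG kG; apply/eqP/commgP/der_central. Qed.

Lemma commDr c k : c \in G^`(1) -> k \in G -> [~ k, c] = 1.
Proof. by move=> cG kG; apply/eqP/commgP/commute_sym/der_central. Qed.

(** In class 2, (g h)^q = g^q h^q [h, g]^C(q, 2), and the last factor vanishes because p divides
    C(q, 2) and G' has exponent p. *)
Lemma expMp g h k : (n <= k)%N -> g \in G -> h \in G ->
  (g * h) ^+ (p ^ k) = g ^+ (p ^ k) * h ^+ (p ^ k).
Proof.
move=> nk gG hG; have R := memRG hG gG.
rewrite expMg_Rmul; [|exact/commute_sym/der_central..].
have /dvdnP[q ->] : p %| 'C(p ^ k, 2).
  by apply: dvdn_bin_pexp2 => // [|/n_gt1]; [apply: leq_trans nk | move/leq_trans; apply].
by rewrite mulnC expgM der_expp // expg1n mulg1.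
Qed.

Lemma exppX c k : (0 < k)%N -> c \in G^`(1) -> c ^+ (p ^ k) = 1.
Proof. by case: k => // k _ cG; rewrite expnS expgM der_expp // expg1n. Qed.

(** The exponents are natural numbers rather than elements of ['F_p]: the p-adic valuation of [i1],
    which is lost modulo p, enters the index. *)
Definition normal_form g (i1 i2 i3 : nat) : Prop :=
  exists2 c, c \in G^`(1) & g = a1 ^+ i1 * a2 ^+ i2 * a3 ^+ i3 * c.

Lemma normal_form_in g i1 i2 i3 : normal_form g i1 i2 i3 -> g \in G.
Proof. by case=> c /derG cG ->; rewrite !groupM ?groupX. Qed.

Let nG' g : g \in G -> g \in 'N(G^`(1)).
Proof. by apply: subsetP; exact: gFnorm. Qed.

(** Normal forms become equalities in the abelian quotient G/G', where exponents simply add. *)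
Lemma normal_form_coset g i1 i2 i3 : g \in G ->
  normal_form g i1 i2 i3 <-> coset G^`(1) g =
    coset G^`(1) a1 ^+ i1 * coset G^`(1) a2 ^+ i2 * coset G^`(1) a3 ^+ i3.
Proof.
move=> gG; split=> [[c cG ->]|E].
  have cG1 := derG cG.
  rewrite !morphM ?morphX ?groupM ?groupX ?nG' //=.
  by rewrite (@coset_id _ _ c) // mulg1.
exists ((a1 ^+ i1 * a2 ^+ i2 * a3 ^+ i3)^-1 * g); last by rewrite mulKVg.
apply: coset_idr; first by rewrite nG' // groupM ?groupV ?groupM ?groupX.
rewrite morphM ?groupV ?morphV ?nG' ?groupV ?groupM ?groupX //=.
by rewrite E !morphM ?morphX ?groupM ?groupX ?nG' //= mulVg.
Qed.

Let cG' g h : g \in G -> h \in G -> commute (coset G^`(1) g) (coset G^`(1) h).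
Proof.
move=> gG hG; apply: (centsP (der_abelian 0 G)); exact: mem_quotient.
Qed.

Lemma normal_formM g h i1 i2 i3 j1 j2 j3 : normal_form g i1 i2 i3 -> normal_form h j1 j2 j3 ->
  normal_form (g * h) (i1 + j1) (i2 + j2) (i3 + j3).
Proof.
move=> ng nh; have gG := normal_form_in ng; have hG := normal_form_in nh.
move/(normal_form_coset _ _ _ gG): ng => Eg; move/(normal_form_coset _ _ _ hG): nh => Eh.
apply/normal_form_coset; first exact: groupM.
rewrite morphM ?nG' //= Eg Eh !expgD !mulgA.
set A1 := coset _ a1; set A2 := coset _ a2; set A3 := coset _ a3.
have c12 : commute (A1 ^+ j1) (A2 ^+ i2) by apply/commuteX2/cG'.
have c13 : commute (A1 ^+ j1) (A3 ^+ i3) by apply/commuteX2/cG'.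
have c23 : commute (A2 ^+ j2) (A3 ^+ i3) by apply/commuteX2/cG'.
congr (_ * _); rewrite -!mulgA; congr (_ * _).
rewrite [in RHS]mulgA c12 -!mulgA; congr (_ * _).
by rewrite c23 !mulgA c13.
Qed.

Lemma normal_formX g i1 i2 i3 k : normal_form g i1 i2 i3 ->
  normal_form (g ^+ k) (i1 * k) (i2 * k) (i3 * k).
Proof.
move=> ng; elim: k => [|k IHk]; last by rewrite expgSr !mulnSr; apply: normal_formM.
by exists 1; rewrite ?group1 // !muln0 !expg0 !mulg1.
Qed.

Lemma normal_form_ex g : g \in G -> exists i1 i2 i3, normal_form g i1 i2 i3.
Proof.
move=> gG; have := mem_quotient G^`(1) gG.
have [[K L defK _] _ _ _] := dprodP dprodG.
have := dprodG; rewrite defK => defG /(mem_dprod defG)[k [l [kK lL E _]]].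
have [k1 [k2 [/cycleP[i1 E1] /cycleP[i2 E2] Ek _]]] := mem_dprod defK kK.
case/cycleP: lL => i3 E3; exists i1, i2, i3; apply/normal_form_coset => //.
by rewrite E Ek E1 E2 E3.
Qed.

Lemma cardG : #|G| = (p ^ m * p ^ n * p ^ n * p ^ 3)%N.
Proof.
have [[K L defK _] _ _ _] := dprodP dprodG.
have := dprodG; rewrite defK => defG.
rewrite -(Lagrange (der_sub 1 G)) cardG' mulnC; congr (_ * _)%N.
rewrite -card_quotient ?der_norm // -(dprod_card defG) -(dprod_card defK).
by rewrite -!orderE o1 o2 o3.
Qed.

Lemma gen3 : <<[set a1; a2; a3]>> = G.
Proof.
apply: Phi_nongen; apply/eqP; rewrite eqEsubset join_subG Phi_sub /=.
apply/andP; split.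
  by apply/subsetP=> g; rewrite !inE => /orP[/orP[]|] /eqP->.
apply/subsetP => g /normal_form_ex[i1 [i2 [i3 [c cG ->]]]].
have cP := subsetP der_sub_Phi _ cG.
rewrite groupM ?(mem_gen (subsetP (subsetUl _ _) _ cP)) //.
by rewrite !groupM ?groupX // mem_gen // !inE eqxx ?orbT.
Qed.

(** * The derived subgroup as a three-dimensional space over F_p *)

Let xG : x \in G^`(1) := memRG a2G a3G.
Let yG : y \in G^`(1) := memRG a3G a1G.
Let zG : z \in G^`(1) := memRG a1G a2G.

(** The group N generated by x, y, z is central, hence normal, and a1, a2, a3 commute modulo N, so
    G/N is abelian. *)
Lemma der_gen3 : <<[set x; y; z]>> = G^`(1).
Proof.
have sNG : <<[set x; y; z]>> \subset G^`(1).
  by rewrite gen_subG; apply/subsetP=> g; rewrite !inE => /orP[/orP[]|] /eqP->.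
apply/eqP; rewrite eqEsubset sNG /=.
pose N := <<[set x; y; z]>>%G; change (G^`(1) \subset N).
have nN : G \subset 'N(N).
  rewrite cents_norm //; apply/centsP => g gG h /(subsetP sNG) hN.
  exact/commute_sym/der_central.
apply: der1_min => //.
rewrite -gen3 quotient_gen; last by rewrite (subset_trans _ nN) // -gen3 subset_gen.
rewrite abelian_gen; apply/centsP => _ /morphimP[g gN gS ->] _ /morphimP[h hN hS ->] /=.
apply/commgP; rewrite -morphR //= coset_id //.
have N1 : [/\ x \in N, y \in N & z \in N].
  by split; rewrite mem_gen // !inE eqxx ?orbT.
have N2 a b : [~ a, b] \in N -> [~ b, a] \in N by rewrite -invg_comm groupV.
case: N1 => Nx Ny Nz; move: gS hS.
rewrite !inE => /orP[/orP[]|] /eqP-> /orP[/orP[]|] /eqP-> //;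
  by rewrite ?commgg ?group1 //; apply: N2.
Qed.

Lemma phi_inj : injective phi.
Proof.
apply: pow3_inj; rewrite ?der_gen3 ?cardG' ?der_expp //; exact: der_commute.
Qed.

Lemma phiD u v : phi (u + v)%R = phi u * phi v.
Proof.
by apply: pow3M; rewrite ?in_setT ?der_expp //; exact: der_commute.
Qed.

Lemma phiMn u k : phi (k%:R *: u)%R = phi u ^+ k.
Proof.
elim: k => [|k IHk]; first by rewrite scale0r /pow3 !mxE !expg0 !mulg1.
by rewrite -natr1 scalerDl scale1r phiD IHk expgSr.
Qed.

Lemma phi0 : phi 0%R = 1.
Proof. by rewrite -(scale0r 0%R) (phiMn _ 0). Qed.

Lemma phiN u : phi (- u)%R = (phi u)^-1.
Proof. by apply: (mulgI (phi u)); rewrite -phiD subrr phi0 mulgV. Qed.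

Lemma phi_der u : phi u \in G^`(1).
Proof. by rewrite /pow3 !groupM ?groupX. Qed.

Definition coord (i1 i2 i3 : nat) : 'rV['F_p]_3 := row3 i1%:R i2%:R i3%:R.

Let one_p : (1%R : 'F_p) = 1%N :> nat. Proof. by []. Qed.

Lemma phi_xyz : [/\ phi (coord 1 0 0) = x, phi (coord 0 1 0) = y & phi (coord 0 0 1) = z].
Proof. by rewrite /coord /pow3 !mxE /= ?expg1 ?expg0 ?mulg1 ?mul1g. Qed.

Lemma comm_nf g h i1 i2 i3 j1 j2 j3 : normal_form g i1 i2 i3 -> normal_form h j1 j2 j3 ->
  [~ g, h] = phi (cross (coord i1 i2 i3) (coord j1 j2 j3)).
Proof.
move=> [c cG ->] [d dG ->]; have cG1 := derG cG; have dG1 := derG dG.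
have [px py pz] := phi_xyz.
have E k : k \in G -> [~ k, a1 ^+ j1 * a2 ^+ j2 * a3 ^+ j3 * d] =
    [~ k, a1] ^+ j1 * [~ k, a2] ^+ j2 * [~ k, a3] ^+ j3.
  by move=> kG; rewrite !commMr ?groupM ?groupX // (commDr dG) // mulg1 !commXr.
set b := _ * d in E *; have bG : b \in G by rewrite !groupM ?groupX.
rewrite !commMl ?groupM ?groupX // (commDl cG) // mulg1 !commXl // !E //.
rewrite !commgg !expg1n !mul1g !mulg1.
rewrite -[[~ a2, a1]]invg_comm -[[~ a3, a2]]invg_comm -[[~ a1, a3]]invg_comm.
(* phi mentions x, y and z, and has to be hidden before they are rewritten. *)
move: phiD phiN phiMn px py pz; set P := (phi); move: P => P PD PN PM px py pz.
rewrite -px -py -pz -!PN -!PM -!PD -!PM -!PD; congr (P _).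
by rewrite /coord !mulr0n !mulr1n cross_expand.
Qed.

(** * Powers, generation and indices in terms of normal forms *)

Lemma normal_form_pow g i1 i2 i3 k : (n <= k)%N -> normal_form g i1 i2 i3 ->
  g ^+ (p ^ k) = a1 ^+ (p ^ k) ^+ i1 * a2 ^+ (p ^ k) ^+ i2 * a3 ^+ (p ^ k) ^+ i3.
Proof.
move=> nk [c cG ->]; have cG1 := derG cG.
rewrite !expMp ?groupM ?groupX // (exppX (leq_trans n_gt0 nk) cG) mulg1.
by rewrite -!expgM ![(_ * p ^ k)%N]mulnC.
Qed.

(** As m - v > n, the powers of a2 and a3 are p-th powers of elements of G', hence trivial; only
    a1^(p^m) is left. *)
Lemma normal_form_pow_deep g v i1 i2 i3 : (v < m - n)%N -> normal_form g (p ^ v * i1) i2 i3 ->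
  g ^+ (p ^ (m - v)) = phi (i1%:R *: row 0 w)%R.
Proof.
move=> vmn /(normal_form_pow (_ : n <= m - v)%N) -> //; last by move: vmn n_lt_m; clear; lia.
have E b i : b ^+ (p ^ n) \in G^`(1) -> b ^+ (p ^ (m - v)) ^+ i = 1.
  have -> : (m - v = n + (m - v - n).-1.+1)%N by move: vmn n_lt_m; clear; lia.
  by rewrite expnD expgM => bG; rewrite exppX ?expg1n.
rewrite (E a2) ?(E a3) ?pw2 ?pw3 ?phi_der // !mulg1.
rewrite -expgM mulnA -expnD subnK; last by move: vmn; clear; lia.
by rewrite expgM pw1 phiMn.
Qed.

(** The a1-part now has order at most p^n modulo G', so all three rows contribute at the same
    power. *)
Lemma normal_form_pow_top g i1 i2 i3 : normal_form g (p ^ (m - n) * i1) i2 i3 ->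
  g ^+ (p ^ n) =
    phi (i1%:R *: row 0 w + i2%:R *: row 1 w + i3%:R *: row 2 w)%R.
Proof.
move/(normal_form_pow (leqnn n)) ->.
have -> : a1 ^+ (p ^ n) ^+ (p ^ (m - n) * i1) = a1 ^+ (p ^ m) ^+ i1.
  by rewrite expgM -[in LHS](expgM a1) -expnD subnKC // ltnW.
by rewrite pw1 pw2 pw3 !phiD !phiMn.
Qed.

(** Generation can be tested modulo Phi(G). There exponents count only modulo p, and three vectors
    with nonzero determinant span the coordinates of every element. *)
Lemma normal_form_gen g h d i1 i2 i3 j1 j2 j3 k1 k2 k3 :
  normal_form g i1 i2 i3 -> normal_form h j1 j2 j3 -> normal_form d k1 k2 k3 ->
  det3 (coord i1 i2 i3) (coord j1 j2 j3) (coord k1 k2 k3) != 0%R ->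
  <<[set g; h; d]>> = G.
Proof.
move=> ng nh nd dn0.
have gG := normal_form_in ng; have hG := normal_form_in nh; have dG := normal_form_in nd.
pose K := <<[set g; h; d]>>%G.
have KG : K \subset G.
  by rewrite gen_subG; apply/subsetP=> a; rewrite !inE => /orP[/orP[]|] /eqP->.
have joinE : 'Phi(G) <*> [set g; h; d] = 'Phi(G) <*> K by rewrite /= joing_idr.
apply: Phi_nongen; rewrite joinE; apply/eqP; rewrite eqEsubset join_subG Phi_sub KG /=.
have nPhi a : a \in G -> a \in 'N('Phi(G)) by apply: subsetP; rewrite gFnorm.
pose c := coset 'Phi(G).
have cp a : a \in G -> c a ^+ p = 1.
  by move=> aG; rewrite /c -morphX ?nPhi //= coset_id // expp_Phi.
have cc a b : a \in G -> b \in G -> commute (c a) (c b).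
  move=> aG bG; apply/commgP; rewrite /c -morphR ?nPhi //= coset_id //.
  exact: (subsetP der_sub_Phi) (memRG aG bG).
have psiE a i j k : normal_form a i j k -> c a = pow3 (c a1) (c a2) (c a3) (coord i j k).
  case=> e eG ->; rewrite /c !morphM ?morphX ?nPhi ?groupM ?groupX ?(derG eG) //=.
  rewrite (@coset_id _ _ e) ?(subsetP der_sub_Phi) // mulg1 /pow3 !row3E.
  by rewrite !expg_Fp_nat ?cp.
have full : pow3 (c a1) (c a2) (c a3) @:
    rowg (mx3 (coord i1 i2 i3) (coord j1 j2 j3) (coord k1 k2 k3)) = <<[set c g; c h; c d]>>.
  by rewrite pow3_gen ?cp //; [|exact: cc..];
    rewrite -(psiE _ _ _ _ ng) -(psiE _ _ _ _ nh) -(psiE _ _ _ _ nd).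
have /eqP rk : row_full (mx3 (coord i1 i2 i3) (coord j1 j2 j3) (coord k1 k2 k3)).
  by rewrite /row_full rank_mx3_full.
have inK a i j k : normal_form a i j k -> a \in 'Phi(G) <*> K.
  move=> na; have aG := normal_form_in na.
  have : c a \in K / 'Phi(G).
    rewrite quotient_gen; last first.
      by rewrite (subset_trans (subset_gen _)) // (subset_trans KG) // gFnorm.
    have -> : [set g; h; d] / 'Phi(G) = [set c g; c h; c d].
      by rewrite /quotient !morphimU !morphim_set1 ?nPhi.
    by rewrite -full (psiE _ _ _ _ na) imset_f // mem_rowg submx_full // /row_full rk.
  case/morphimP => b bN bK /= cab.
  have abP : a * b^-1 \in 'Phi(G).
    apply: coset_idr; first by rewrite groupM ?groupV // nPhi.
    by rewrite morphM ?morphV ?groupV ?(nPhi a) //= -cab mulgV.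
  by rewrite -(mulgKV b a) groupM // mem_gen // inE ?abP ?bK ?orbT.
rewrite -{1}gen3 gen_subG; apply/subsetP => a; rewrite !inE => /orP[/orP[]|] /eqP->.
- by apply: (inK _ 1 0 0)%N; exists 1; rewrite ?group1 // !mulg1 expg1.
- by apply: (inK _ 0 1 0)%N; exists 1; rewrite ?group1 // !mulg1 mul1g expg1.
- by apply: (inK _ 0 0 1)%N; exists 1; rewrite ?group1 // !mulg1 !mul1g expg1.
Qed.

(** The element [d] completes g, h to a generating set, and p^(m + n + n) is the order of G/G': the
    bounds p^al, p^be, p^de multiply to exactly that order, so all of them are attained. *)
Lemma index_nf g h d i1 i2 i3 j1 j2 j3 k1 k2 k3 (al be de : nat)
    (u v : 'rV['F_p]_3) :
  normal_form g i1 i2 i3 -> normal_form h j1 j2 j3 -> normal_form d k1 k2 k3 ->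
  det3 (coord i1 i2 i3) (coord j1 j2 j3) (coord k1 k2 k3) != 0%R ->
  g ^+ (p ^ al) = phi u -> h ^+ (p ^ be) = phi v ->
  d ^+ (p ^ de) \in <<[set g; h]>> <*> G^`(1) ->
  (al + be + de = m + n + n)%N ->
  (#|G : <<[set g; h]>>| *
    p ^ \rank (mx3 u v (cross (coord i1 i2 i3) (coord j1 j2 j3))) = p ^ (de + 3))%N.
Proof.
move=> ng nh nd dn0 gu hv dH sum.
set c := cross _ _.
have ghc : [~ g, h] = phi c by apply: comm_nf.
have cardN : #|<<[set phi u; phi v; phi c]>>| = (p ^ \rank (mx3 u v c))%N.
  apply: card_pow3_gen; rewrite ?der_expp //; try exact: der_commute.
  exact: phi_inj.
have NG' : <<[set phi u; phi v; phi c]>> \subset G^`(1).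
  by rewrite gen_subG; apply/subsetP=> a; rewrite !inE => /orP[/orP[]|] /eqP->; exact: phi_der.
rewrite -cardN expnD -cardG'.
have pe k : (0 < p ^ k)%N by rewrite expn_gt0 p_gt0.
apply: (index_gen2 (pe al) (pe be) (pe de) (normal_form_gen ng nh nd dn0)) => //.
- exact: subset_trans NG' (subset_trans der_sub_Phi PhiZ).
- have gH : g \in <<[set g; h]>> by rewrite mem_gen // !inE eqxx.
  have hH : h \in <<[set g; h]>> by rewrite mem_gen // !inE eqxx orbT.
  rewrite gen_subG; apply/subsetP=> a; rewrite !inE => /orP[/orP[]|] /eqP->.
  + by rewrite -gu groupX.
  + by rewrite -hv groupX.
  + by rewrite -ghc groupR.
- by rewrite ghc mem_gen // !inE eqxx orbT.
- by rewrite gu mem_gen // !inE eqxx.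
- by rewrite hv mem_gen // !inE eqxx orbT.
- by rewrite cardG cardG' -!expnD sum.
Qed.

Lemma normal_form_a1 : normal_form a1 1 0 0.
Proof. by exists 1; rewrite ?group1 // !mulg1 expg1. Qed.

Lemma normal_form_a2 : normal_form a2 0 1 0.
Proof. by exists 1; rewrite ?group1 // !mulg1 mul1g expg1. Qed.

Lemma normal_form_a3 : normal_form a3 0 0 1.
Proof. by exists 1; rewrite ?group1 // !mulg1 !mul1g expg1. Qed.

Lemma coprime_expg_mem (K : {group gT}) t i :
  t \in G -> ~~ (p %| i) -> t ^+ i \in K -> t \in K.
Proof.
move=> tG ip tK.
have : generator <[t]> (t ^+ i).
  rewrite generator_coprime; apply: (@pnat_coprime p); last by rewrite p'natE.
  exact: mem_p_elt pG tG.
by rewrite /generator -cycle_subG => /eqP->; rewrite cycle_subG.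
Qed.

(** The completing generator depends on v. For v = 0, g accounts for a1, and a2 or a3 completes. For
    v > 0 the first coordinate of g vanishes modulo p and a1 itself completes. *)
Lemma index_low g h v i0 i2 i3 k l : (v < m - n)%N -> ~~ (p %| i0) ->
  normal_form g (p ^ v * i0) i2 i3 -> normal_form h 0 k l ->
  cross (coord (p ^ v * i0) i2 i3) (coord 0 k l) != 0%R ->
  (#|G : <<[set g; h]>>| *
    p ^ \rank (mx3 (i0%:R *: row 0%R w) (k%:R *: row 1%R w + l%:R *: row 2%R w)
                   (cross (coord (p ^ v * i0) i2 i3) (coord 0 k l)))%R
   = p ^ (n + v + 3))%N.
Proof.
move=> vmn pi0 ng nh cn0.
have gp := normal_form_pow_deep vmn ng.
have hp : h ^+ (p ^ n) = phi (k%:R *: row 1%R w + l%:R *: row 2%R w)%R.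
  by rewrite (@normal_form_pow_top h 0 k l) ?muln0 // scale0r add0r.
have sum : (m - v + n + (n + v) = m + n + n)%N by move: vmn; clear; lia.
have i0n0 : (i0%:R : 'F_p)%R != 0%R by rewrite -(dvdn_pcharf (pchar_Fp p_pr)).
case: v => [|v] in vmn ng cn0 gp sum *.
  have Ec : coord (p ^ 0 * i0) i2 i3 = row3 i0%:R i2%:R i3%:R by rewrite mul1n.
  have [k0|kn0] := eqVneq (k%:R : 'F_p)%R 0%R.
    have ln0 : (l%:R : 'F_p)%R != 0%R.
      apply: contra cn0 => /eqP l0.
      by rewrite /coord k0 l0 cross_row3 !mulr0 !subr0 row3_0.
    apply: (index_nf ng nh normal_form_a2 _ gp hp) => //.
      by rewrite Ec det3_e2 oppr_eq0 mulf_neq0.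
    by rewrite addn0 pw2 mem_gen // inE phi_der orbT.
  apply: (index_nf ng nh normal_form_a3 _ gp hp) => //.
    by rewrite Ec det3_e3 mulf_neq0.
  by rewrite addn0 pw3 mem_gen // inE phi_der orbT.
have Ec : coord (p ^ v.+1 * i0) i2 i3 = row3 0 i2%:R i3%:R.
  by rewrite /coord natrM natrX pchar_Fp_0 // expr0n mul0r.
apply: (index_nf ng nh normal_form_a1 _ gp hp) => //.
  rewrite Ec det3_e1; apply: contra cn0 => /eqP c0.
  by rewrite Ec cross_row3 c0 !mul0r !mulr0 subrr row3_0.
pose K := (<<[set g; h]>> <*> G^`(1))%G.
(* Up to factors in G', g^(p^n) is the i0-th power of a1^(p^(n + v)), where v is the valuation, and
   i0 is prime to p. *)
apply: (@coprime_expg_mem K _ i0) => //; first exact: groupX.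
have gK : g ^+ (p ^ n) \in K by rewrite groupX // mem_gen // inE mem_gen // !inE eqxx.
have G'K c : c \in G^`(1) -> c \in K by move=> cG; rewrite mem_gen // inE cG orbT.
rewrite (normal_form_pow (leqnn n) ng) in gK.
rewrite groupMr in gK; last by rewrite G'K // groupX // pw3 phi_der.
rewrite groupMr in gK; last by rewrite G'K // groupX // pw2 phi_der.
by move: gK; rewrite -!expgM mulnA -expnD.
Qed.

(** Since m > n, both first coordinates vanish modulo p: the commutator is a power of x, and a1 is
    the completing generator. *)
Lemma index_high g h i1 i2 i3 j1 j2 j3 :
  normal_form g (p ^ (m - n) * i1) i2 i3 -> normal_form h (p ^ (m - n) * j1) j2 j3 ->
  (i2%:R * j3%:R - i3%:R * j2%:R : 'F_p)%R != 0%R ->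
  (#|G : <<[set g; h]>>| *
    p ^ \rank (mx3 (i1%:R *: row 0%R w + i2%:R *: row 1%R w + i3%:R *: row 2%R w)
                   (j1%:R *: row 0%R w + j2%:R *: row 1%R w + j3%:R *: row 2%R w)
                   (row3 (i2%:R * j3%:R - i3%:R * j2%:R) 0 0))%R
   = p ^ (m + 3))%N.
Proof.
move=> ng nh cn0.
have E i b c : coord (p ^ (m - n) * i) b c = row3 0 b%:R c%:R.
  by rewrite /coord natrM natrX pchar_Fp_0 // expr0n subn_eq0 leqNgt n_lt_m mul0r.
have -> : (row3 (i2%:R * j3%:R - i3%:R * j2%:R) 0 0 : 'rV['F_p]_3)%R =
    cross (coord (p ^ (m - n) * i1) i2 i3) (coord (p ^ (m - n) * j1) j2 j3).
  by rewrite !E cross_row3 !mul0r !mulr0 subrr.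
apply: (index_nf ng nh normal_form_a1 _ (normal_form_pow_top ng) (normal_form_pow_top nh)).
- by rewrite !E det3_e1.
- by rewrite pw1 mem_gen // inE phi_der orbT.
- by clear; lia.
Qed.

(** A proper K lies in M = Phi(H) K, which is still proper because Phi(H) consists of nongenerators.
    As H/Phi(H) has order at most p^2, M/Phi(H) is cyclic; as Phi(H) <= Phi(G) is central, M is
    abelian. *)
Lemma A1_gen2 g h : g \in G -> h \in G -> [~ g, h] != 1 ->
  A1_subgroup G <<[set g; h]>>%G.
Proof.
move=> gG hG gh1; set H := <<[set g; h]>>%G.
have gH : g \in H by rewrite mem_gen // !inE eqxx.
have hH : h \in H by rewrite mem_gen // !inE eqxx orbT.
have HG : H \subset G by rewrite gen_subG; apply/subsetP => a /set2P[]->.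
split=> //; split.
  by apply: contra gh1 => /centsP cHH; apply/commgP/cHH.
move=> K prK; have pH := pgroupS HG pG; have KH := proper_sub prK.
have PhiH := PhiS pG HG.
have nPhi : H \subset 'N('Phi(H)) by exact: gFnorm.
pose M := ('Phi(H) <*> K)%G.
have MH : M \subset H by rewrite join_subG Phi_sub.
have prM : M \proper H.
  rewrite properEneq MH andbT; apply/eqP => eqMH.
  have := @Phi_nongen _ H K eqMH; rewrite genGid => eqKH.
  by rewrite eqKH properxx in prK.
have ZM : 'Phi(H) \subset 'Z(M).
  rewrite subsetI joing_subl centsC (subset_trans MH) // (subset_trans HG) //.
  by rewrite centsC (subset_trans PhiH) // (subset_trans PhiZ) // subsetIr.
suff : abelian M by apply: abelianS; exact: joing_subr.
apply: (cyclic_factor_abelian ZM).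
have leH : (#|H / 'Phi(H)| <= p * p)%N.
  rewrite quotient_gen; last by rewrite (subset_trans (subset_gen _)).
  have -> : [set g; h] / 'Phi(H) = [set coset 'Phi(H) g; coset 'Phi(H) h].
    by rewrite /quotient morphimU !morphim_set1 // (subsetP nPhi).
  have xPhi a : a \in H -> coset 'Phi(H) a ^+ p = 1.
    move=> aH; rewrite -morphX ?(subsetP nPhi) //= coset_id //.
    rewrite (Phi_joing pH) (subsetP (joing_subr _ _)) //.
    by have := Mho_p_elt 1 aH (mem_p_elt pH aH); rewrite expn1.
  apply: leq_trans (card_gen2_commute _) _.
    apply/commgP; rewrite -morphR ?(subsetP nPhi) //= coset_id //.
    by rewrite (Phi_joing pH) (subsetP (joing_subl _ _)) // mem_commg.
  by apply: leq_mul; apply: order_le_expg1; rewrite ?xPhi.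
have ltM : (#|M / 'Phi(H)| < p * p)%N.
  apply: leq_trans leH; apply: proper_card.
  by rewrite quotient_proper // /normal ?joing_subl ?Phi_sub // (subset_trans MH).
have pM : p.-group (M / 'Phi(H)) by rewrite quotient_pgroup // (pgroupS MH).
have [k cM] := p_natP pM; move: ltM; rewrite cM mulnn ltn_exp2l ?prime_gt1 //.
case: k cM => [|[|//]] cM _.
  by rewrite (@card1_trivg _ (M / 'Phi(H))%G) // cyclic1.
by apply: prime_cyclic; rewrite cM expn1.
Qed.

(** A non-commuting pair of H generates a non-abelian subgroup, which cannot be proper. *)
Lemma A1_is_gen2 (H : {group gT}) : A1_subgroup G H ->
  exists g h, [/\ g \in G, h \in G, [~ g, h] != 1 & H = <<[set g; h]>>%G].
Proof.
case=> HG [nab minH].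
have [g gH [h hH gh]] : exists2 g, g \in H & exists2 h, h \in H & [~ g, h] != 1.
  case/subsetPn: nab => g gH; rewrite -sub_cent1 => /subsetPn[h hH hg].
  by exists g => //; exists h => //; apply: contra hg => /commgP cgh; apply/cent1P.
have gG := subsetP HG _ gH; have hG := subsetP HG _ hH.
exists g, h; split=> //; apply/val_inj/eqP; rewrite eq_sym eqEproper /=.
have sH : <<[set g; h]>> \subset H by rewrite gen_subG; apply/subsetP => a /set2P[]->.
rewrite sH; apply/negP => /(minH <<[set g; h]>>%G)/centsP cgh.
case/negP: gh; apply/commgP/cgh; by rewrite mem_gen // !inE eqxx ?orbT.
Qed.

(** * Reduction of a generating pair to low or high form *)

Definition low_form (g h : gT) : Prop := exists v i0 i2 i3 k l : nat,
  [/\ (v < m - n)%N, ~~ (p %| i0), normal_form g (p ^ v * i0) i2 i3 & normal_form h 0 k l].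

Definition high_form (g h : gT) : Prop := exists i1 i2 i3 j1 j2 j3 : nat,
  normal_form g (p ^ (m - n) * i1) i2 i3 /\ normal_form h (p ^ (m - n) * j1) j2 j3.

Lemma normal_form_a1_mod g i j i2 i3 : normal_form g i i2 i3 ->
  i = j %[mod p ^ m] -> normal_form g j i2 i3.
Proof.
move=> ng ij; have gG := normal_form_in ng; move/(normal_form_coset _ _ _ gG): ng => E.
apply/(normal_form_coset _ _ _ gG); rewrite E; congr (_ * _ * _).
by apply/eqP; rewrite eq_expg_mod_order o1 ij.
Qed.

Lemma low_form_ex g h i1 i2 i3 j1 j2 j3 : normal_form g i1 i2 i3 -> normal_form h j1 j2 j3 ->
  ~~ (p ^ (m - n) %| i1) -> p ^ logn p i1 %| j1 ->
  exists2 h', <<[set g; h]>> = <<[set g; h']>> & low_form g h'.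
Proof.
move=> ng nh ndiv1 div2.
have i1_gt0 : (0 < i1)%N by case: i1 ndiv1 {ng div2} => //; rewrite dvdn0.
have [i0 cop E1] := pfactor_coprime p_pr i1_gt0.
set v := logn p i1 in div2 E1; case/dvdnP: div2 => j0 E2.
have vmn : (v < m - n)%N.
  by rewrite ltnNge; apply: contra ndiv1 => le; rewrite E1 dvdn_mull // dvdn_exp2l.
have cop' : coprime (p ^ m) i0 by rewrite coprimeXl.
have i0_gt0 : (0 < i0)%N by move: i1_gt0; rewrite E1 muln_gt0 => /andP[].
have [u Eu] : exists u, u * i0 = 1 %[mod p ^ m].
  case: (egcdnP (p ^ m) i0_gt0) => a b E _; exists a.
  by rewrite E (eqP (_ : coprime i0 (p ^ m))) ?modnMDl // coprime_sym.
(* This is - j0 / i0 modulo p^m: [u] inverts i0, and p^m - 1 stands for -1 among natural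
   exponents. *)
pose k := ((p ^ m).-1 * j0 * u)%N.
have pm_gt0 : (0 < p ^ m)%N by rewrite expn_gt0 p_gt0.
exists (h * g ^+ k).
  apply/eqP; rewrite eqEsubset !gen_subG; apply/andP; split.
    apply/subsetP => a /set2P[]->; first by rewrite mem_gen // !inE eqxx.
    rewrite -(@groupMr _ _ (g ^+ k)) ?groupX // mem_gen // !inE eqxx ?orbT //.
  apply/subsetP => a /set2P[]->; first by rewrite mem_gen // !inE eqxx.
  by rewrite groupM ?groupX // mem_gen // !inE eqxx ?orbT.
exists v, i0, i2, i3, (j2 + i2 * k)%N, (j3 + i3 * k)%N; split=> //.
- by rewrite -prime_coprime.
- by rewrite mulnC -E1.
apply: normal_form_a1_mod (normal_formM nh (normal_formX k ng)) _.
rewrite E1 E2 mod0n; apply/eqP; change (p ^ m %| j0 * p ^ v + i0 * p ^ v * k).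
have -> : (j0 * p ^ v + i0 * p ^ v * k = p ^ v * (j0 + (p ^ m).-1 * j0 * (u * i0)))%N.
  by rewrite /k; ring.
apply: dvdn_mull; rewrite /dvdn -modnDmr -modnMmr Eu modnMmr muln1 modnDmr.
by rewrite -mulSn prednK // modnMr.
Qed.

Lemma A1_forms (H : {group gT}) : A1_subgroup G H ->
  exists g h, [/\ H = <<[set g; h]>>%G, [~ g, h] != 1 & low_form g h \/ high_form g h].
Proof.
move=> HA1; have [_ [nab _]] := HA1.
have comm g h : <<[set g; h]>> = H -> [~ g, h] != 1.
  move=> E; apply: contra nab => /commgP cgh; rewrite -E abelian_gen.
  by apply/centsP => a /set2P[]-> b /set2P[]->.
have low g h : <<[set g; h]>> = H ->
    (exists2 h', <<[set g; h]>> = <<[set g; h']>> & low_form g h') ->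
  exists g h, [/\ H = <<[set g; h]>>%G, [~ g, h] != 1 & low_form g h \/ high_form g h].
  move=> E [h' E' lf]; exists g, h'; split; last by left.
    by apply: val_inj; rewrite /= -E' E.
  by apply: comm; rewrite -E'.
have [g [h [gG hG gh EH]]] := A1_is_gen2 HA1.
have [i1 [i2 [i3 ng]]] := normal_form_ex gG; have [j1 [j2 [j3 nh]]] := normal_form_ex hG.
have Hgh : <<[set g; h]>> = H by rewrite EH.
have Hhg : <<[set h; g]>> = H by rewrite setUC.
(* Divisibility is split off before valuations are compared because [logn p 0] is 0 although 0 is
   divisible by every power. The generator of smaller valuation then plays the part of g. *)
have [d1|nd1] := boolP (p ^ (m - n) %| i1); have [d2|nd2] := boolP (p ^ (m - n) %| j1).
- exists g, h; split=> //; right; case/dvdnP: d1 d2 => k1 E1 /dvdnP[k2 E2].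
  by exists k1, i2, i3, k2, j2, j3; rewrite ![(p ^ _ * _)%N]mulnC -E1 -E2.
- apply: (low h g Hhg (low_form_ex nh ng nd2 _)).
  apply: dvdn_trans d1; rewrite dvdn_exp2l //.
  have j1_gt0 : (0 < j1)%N by case: j1 nd2 {nh} => //; rewrite dvdn0.
  by move: nd2; rewrite pfactor_dvdn // -ltnNge => /ltnW.
- apply: (low g h Hgh (low_form_ex ng nh nd1 _)).
  apply: dvdn_trans d2; rewrite dvdn_exp2l //.
  have i1_gt0 : (0 < i1)%N by case: i1 nd1 {ng} => //; rewrite dvdn0.
  by move: nd1; rewrite pfactor_dvdn // -ltnNge => /ltnW.
have i1_gt0 : (0 < i1)%N by case: i1 nd1 {ng} => //; rewrite dvdn0.
have j1_gt0 : (0 < j1)%N by case: j1 nd2 {nh} => //; rewrite dvdn0.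
have [le|le] := leqP (logn p i1) (logn p j1).
  by apply: (low g h Hgh (low_form_ex ng nh nd1 _)); rewrite pfactor_dvdn.
by apply: (low h g Hhg (low_form_ex nh ng nd2 _)); rewrite pfactor_dvdn // ltnW.
Qed.

(** * Exponents of A1-subgroups as ranks *)

Local Notation W1 := (row 0%R w).
Local Notation W2 := (row 1%R w).
Local Notation W3 := (row 2%R w).

Let eq_expp a b c : (p ^ a * p ^ b = p ^ c)%N -> (a + b = c)%N.
Proof. by rewrite -expnD => /(expnI (prime_gt1 p_pr)). Qed.

Lemma low_form_rank g h : low_form g h -> [~ g, h] != 1 ->
  exists (v : nat) (a b c k l : 'F_p),
  let t := cross (row3 (if v == 0%N then a else 0%R) b c) (row3 0%R k l) in
  [/\ (v < m - n)%N, a != 0%R, t != 0%R &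
    (#|G : <<[set g; h]>>| * p ^ \rank (mx3 (a *: W1) (k *: W2 + l *: W3) t)%R
      = p ^ (n + v + 3))%N].
Proof.
move=> [v [i0 [i2 [i3 [k [l [vmn pi0 ng nh]]]]]]] gh.
have tE : coord (p ^ v * i0) i2 i3 = row3 (if v == 0%N then i0%:R else 0)%R i2%:R i3%:R.
  rewrite /coord natrM natrX pchar_Fp_0 // expr0n.
  by case: eqP => _; rewrite ?mul1r ?mul0r.
have tn0 : cross (coord (p ^ v * i0) i2 i3) (coord 0 k l) != 0%R.
  by apply: contra gh; rewrite (comm_nf ng nh) => /eqP->; rewrite phi0.
exists v, i0%:R%R, i2%:R%R, i3%:R%R, k%:R%R, l%:R%R.
have := index_low vmn pi0 ng nh tn0; move: tn0; rewrite tE => tn0 idx; split=> //.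
by rewrite -(dvdn_pcharf (pchar_Fp p_pr)).
Qed.

Lemma high_form_rank g h : high_form g h -> [~ g, h] != 1 ->
  exists i1 i2 i3 j1 j2 j3 : 'F_p,
  (i2 * j3 - i3 * j2 != 0)%R /\
  (#|G : <<[set g; h]>>| *
    p ^ \rank (mx3 (i1 *: W1 + i2 *: W2 + i3 *: W3)
                   (j1 *: W1 + j2 *: W2 + j3 *: W3)
                   (row3 (i2 * j3 - i3 * j2) 0 0))%R = p ^ (m + 3))%N.
Proof.
move=> [i1 [i2 [i3 [j1 [j2 [j3 [ng nh]]]]]]] gh.
exists i1%:R%R, i2%:R%R, i3%:R%R, j1%:R%R, j2%:R%R, j3%:R%R.
suff dn0 : (i2%:R * j3%:R - i3%:R * j2%:R : 'F_p)%R != 0%R.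
  by split=> //; exact: index_high.
apply: contra gh => /eqP d0; rewrite (comm_nf ng nh) /coord !natrM natrX pchar_Fp_0 //.
have -> : (0 ^+ (m - n) = 0 :> 'F_p)%R by rewrite expr0n subn_eq0 leqNgt n_lt_m.
by rewrite !mul0r cross_row3 d0 !mulr0 !mul0r subrr row3_0 phi0.
Qed.

Lemma A1_index_forms : index_forms m n W1 W2 W3 (A1_exponent p G).
Proof.
move=> i [H /A1_forms[g [h [-> gh [|]]]]] /=.
  move/low_form_rank => /(_ gh)[v [a [b [c [k [l [? ? ? idx]]]]]]] iH; left.
  by exists v, a, b, c, k, l; split=> //; apply: eq_expp; rewrite -iH.
move/high_form_rank => /(_ gh)[i1 [i2 [i3 [j1 [j2 [j3 [? idx]]]]]]] iH; right.
by exists i1, i2, i3, j1, j2, j3; split=> //; apply: eq_expp; rewrite -iH.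
Qed.

Let A1_exponent_ex (H : {group gT}) r d : A1_subgroup G H ->
  (#|G : H| * p ^ r = p ^ d)%N -> exists2 i, A1_exponent p G i & (i + r = d)%N.
Proof.
move=> A1H E; have /p_natP[i iH] : p.-nat #|G : H|.
  by apply: pnat_dvd pG; exact: dvdn_indexg.
by exists i; [exists H | apply: eq_expp; rewrite -iH].
Qed.

Lemma A1_low_index_ex : low_index_ex n W1 W2 W3 (A1_exponent p G).
Proof.
(* The exponents b, c are chosen so that the first entry bl - ck of the commutator is the prescribed
   s. *)
move=> s k l kl0; have [b [c sE]] : exists b c : 'F_p, (b * l - c * k = s)%R.
  have [k0|kn0] := eqVneq k 0%R.
    by exists (s / l)%R, 0%R; rewrite mul0r subr0 divfK //; move: kl0; rewrite k0 eqxx.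
  by exists 0%R, (- s / k)%R; rewrite mul0r sub0r divfK // opprK.
pose g := a1 * a2 ^+ b * a3 ^+ c; pose h := a2 ^+ k * a3 ^+ l.
have ng : normal_form g (p ^ 0 * 1) b c by exists 1; rewrite ?group1 // mulg1 expg1.
have nh : normal_form h 0 k l by exists 1; rewrite ?group1 // mulg1 mul1g.
have tE : cross (coord (p ^ 0 * 1) b c) (coord 0 k l) = row3 s (- l)%R k.
  by rewrite /coord !natr_Zp cross_row3 -sE !mulr0n !mulr1n !mulr0 !mul1r subr0 sub0r.
have tn0 : row3 s (- l)%R k != 0%R.
  by rewrite row3_eq0 oppr_eq0 !negb_and [(l != 0%R) || _]orbC kl0 orbT.
apply: (@A1_exponent_ex <<[set g; h]>>%G).
  apply: A1_gen2 (normal_form_in ng) (normal_form_in nh) _.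
  by rewrite (comm_nf ng nh) tE -phi0 (inj_eq phi_inj).
have := @index_low g h 0 1 b c k l; rewrite tE !natr_Zp scale1r addn0; apply => //.
  by rewrite subn_gt0.
by rewrite dvdn1 neq_ltn prime_gt1 ?orbT.
Qed.

Lemma A1_high_index_ex : high_index_ex m W1 W2 W3 (A1_exponent p G).
Proof.
move=> i j; pose g := a1 ^+ (p ^ (m - n) * i) * a2; pose h := a1 ^+ (p ^ (m - n) * j) * a3.
have ng : normal_form g (p ^ (m - n) * i) 1 0 by exists 1; rewrite ?group1 // !mulg1 expg1.
have nh : normal_form h (p ^ (m - n) * j) 0 1 by exists 1; rewrite ?group1 // !mulg1 expg1.
have tE : (1%:R * 1%:R - 0%:R * 0%:R = 1 :> 'F_p)%R.
  by rewrite mulr0n mulr1n mulr1 mulr0 subr0.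
have := index_high ng nh; rewrite tE oner_eq0 => /(_ isT).
rewrite !natr_Zp !mulr0n !mulr1n !scale1r !scale0r !addr0 => idx.
apply: (@A1_exponent_ex <<[set g; h]>>%G) idx.
apply: A1_gen2 (normal_form_in ng) (normal_form_in nh) _.
rewrite (comm_nf ng nh) /coord !natrM natrX pchar_Fp_0 //.
have -> : (0 ^+ (m - n) = 0 :> 'F_p)%R by rewrite expr0n subn_eq0 leqNgt n_lt_m.
rewrite cross_row3 tE -phi0 (inj_eq phi_inj).
apply/eqP => /rowP/(_ 0%R)/eqP; by rewrite row3E mxE oner_eq0.
Qed.

End Setup.

(* The matrices under \rank may agree only up to conversion, which lia does not
   see; [set] identifies them. *)
Ltac rank_lia :=
  repeat (let r := fresh "r" in set r := (\rank _); clearbody r); clear; lia.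

(** * Bounds on the exponents from the rows of the matrix *)

Section Bounds.
Variables (F : fieldType) (m n : nat) (W1 W2 W3 : 'rV[F]_3) (idx : nat -> Prop).
Hypothesis n_lt_m : (n < m)%N.

Local Open Scope ring_scope.

Hypothesis idx_forms : index_forms m n W1 W2 W3 idx.
Hypothesis idx_low : low_index_ex n W1 W2 W3 idx.
Hypothesis idx_high : high_index_ex m W1 W2 W3 idx.

Let rk3 u v t := @rank_mx3_le3 F u v t.

(** Ranks are at most 3, so the low form gives at least n + v and the high form at least m > n;
    exponent n needs v = 0 and full rank. *)
Lemma idx_n : idx n -> exists a b c k l : F,
  det3 (a *: W1) (k *: W2 + l *: W3) (cross (row3 a b c) (row3 0 k l)) != 0.
Proof.
case/idx_forms => [[v [a [b [c [k [l /= [vmn a0 t0 E]]]]]]]|].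
  have v0 : v = 0%N by move: E (rk3 (a *: W1) (k *: W2 + l *: W3)
    (cross (row3 (if v == 0%N then a else 0) b c) (row3 0 k l))); rank_lia.
  exists a, b, c, k, l; rewrite -rank_mx3_full; move: E; rewrite v0 addn0.
  by move=> /addnI ->.
move=> [i1 [i2 [i3 [j1 [j2 [j3 [_ E]]]]]]].
have r3 := rk3 (i1 *: W1 + i2 *: W2 + i3 *: W3) (j1 *: W1 + j2 *: W2 + j3 *: W3)
  (row3 (i2 * j3 - i3 * j2) 0 0).
by exfalso; move: E r3 n_lt_m; rank_lia.
Qed.

Lemma not_idx_n_row1 : W1 = 0 -> ~ idx n.
Proof.
move=> W10 /idx_n[a [b [c [k [l]]]]]; rewrite W10 => /eqP; apply.
by rewrite /det3 !mxE; ring.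
Qed.

Lemma not_idx_n_row23 : W2 = 0 -> W3 = 0 -> ~ idx n.
Proof.
move=> W20 W30 /idx_n[a [b [c [k [l]]]]]; rewrite W20 W30 => /eqP; apply.
by rewrite /det3 !mxE; ring.
Qed.

(** Here k W2 + l W3 = (0, -l, k), while the commutator is (bl - ck, -al, ak): they are proportional
    off the first coordinate, the only one in which W1 lives. *)
Lemma not_idx_n_skew x : W1 = row3 x 0 0 -> W2 = row3 0 0 1 -> W3 = row3 0 (-1) 0 ->
  ~ idx n.
Proof.
move=> E1 E2 E3 /idx_n[a [b [c [k [l]]]]]; rewrite E1 E2 E3 => /eqP; apply.
by rewrite /det3 !mxE /=; ring.
Qed.

(** The scalar is the determinant of W1, k W2 + l W3 and (s, -l, k), written out so that it can be
    evaluated on concrete rows. *)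
Lemma idx_le_n (s k l : F) :
  let u j := k * W2 0 j + l * W3 0 j in
  W1 0 0 * (u 1 * k + u 2 * l) - W1 0 1 * (u 0 * k - u 2 * s)
    - W1 0 2 * (u 0 * l + u 1 * s) != 0 -> exists2 i, idx i & (i <= n)%N.
Proof.
move=> /= d0; have kl : (k != 0) || (l != 0).
  apply: contraNT d0; rewrite negb_or !negbK => /andP[/eqP-> /eqP->].
  by apply/eqP; ring.
have [i idxi E] := idx_low s kl; exists i => //.
have /eqP r3 : \rank (mx3 W1 (k *: W2 + l *: W3) (row3 s (- l) k)) == 3%N.
  rewrite rank_mx3_full; apply: contra d0 => /eqP det0; rewrite -[X in _ == X]det0.
  by apply/eqP; rewrite /det3 !mxE /=; ring.
move: E; rewrite r3; rank_lia.
Qed.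

(** If the rank is 1 for both s = 0 and s = 1, a row of the matrix is a multiple of (0, -l, k) and
    of (1, -l, k). Comparing first coordinates makes it zero, so a nonzero row yields rank at least
    2 for one of the two. *)
Lemma idx_le_n1 : [|| W1 != 0, W2 != 0 | W3 != 0] ->
  exists2 i, idx i & (i <= n + 1)%N.
Proof.
have aux (s k l : F) : (k != 0) || (l != 0) ->
    (1 < \rank (mx3 W1 (k *: W2 + l *: W3) (row3 s (- l) k)))%N ->
    exists2 i, idx i & (i <= n + 1)%N.
  move=> kl r1; have [i idxi E] := idx_low s kl; exists i => //.
  by move: E r1; rank_lia.
have try (k l : F) (u : 'rV[F]_3) : (k != 0) || (l != 0) -> u != 0 ->
    (forall s, (\rank (mx3 W1 (k *: W2 + l *: W3) (row3 s (- l)  k)) <= 1)%N ->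
      exists c, u = c *: row3 s (- l) k) ->
    exists2 i, idx i & (i <= n + 1)%N.
  move=> kl u0 H.
  have [/H[c0 E0]|r0] := leqP (\rank (mx3 W1 (k *: W2 + l *: W3) (row3 0 (- l) k))) 1;
    last exact: aux r0.
  have [/H[c1 E1]|r1] := leqP (\rank (mx3 W1 (k *: W2 + l *: W3) (row3 1 (- l) k))) 1;
    last exact: aux r1.
  case/eqP: u0; rewrite E1; move/rowP: E0; rewrite E1 => /(_ 0).
  by rewrite !mxE /= mulr1 mulr0 => ->; rewrite scale0r.
have tn0 (s k l : F) : (k != 0) || (l != 0) -> row3 s (- l) k != 0.
  by rewrite row3_eq0 oppr_eq0 !negb_and [(l != 0) || _]orbC => ->; rewrite orbT.
have k1 : ((1 : F) != 0) || ((0 : F) != 0) by rewrite oner_eq0.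
have l1 : ((0 : F) != 0) || ((1 : F) != 0) by rewrite oner_eq0 orbT.
case/or3P => u0.
- apply: (try 1 0 W1) => // s /(rank_mx3_le1 (tn0 s 1 0 k1))[c [_ [E _]]].
  by exists c.
- apply: (try 1 0 W2) => // s /(rank_mx3_le1 (tn0 s 1 0 k1))[_ [c [_ E]]].
  by exists c; rewrite -E scale1r scale0r addr0.
- apply: (try 0 1 W3) => // s /(rank_mx3_le1 (tn0 s 0 1 l1))[_ [c [_ E]]].
  by exists c; rewrite -E scale1r scale0r add0r.
Qed.

Lemma idx_trivial i : W1 = 0 -> W2 = 0 -> W3 = 0 -> idx i -> (n + 2 <= i)%N.
Proof.
move=> W10 W20 W30 /idx_forms; rewrite W10 W20 W30; case=> [[v [a [b [c [k [l /= [_ _ _]]]]]]]|].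
  rewrite !scaler0 addr0; set t := cross _ _.
  have := @rank_mx3_mul F 0 0 t 0 0; rewrite !scale0r => /(_ erefl erefl).
  by rank_lia.
move=> [i1 [i2 [i3 [j1 [j2 [j3 [_]]]]]]]; rewrite !scaler0 !addr0.
set t := row3 _ _ _; have := @rank_mx3_mul F 0 0 t 0 0; rewrite !scale0r => /(_ erefl erefl).
by move: n_lt_m; rank_lia.
Qed.

(** Both power relations then lie in the span of x, which also contains the commutator: the rank is
    1. *)
Lemma idx_ge_m2 (i j : F) :
  i * W1 0 1 + W2 0 1 = 0 -> i * W1 0 2 + W2 0 2 = 0 ->
  j * W1 0 1 + W3 0 1 = 0 -> j * W1 0 2 + W3 0 2 = 0 ->
  exists2 e, idx e & (m + 2 <= e)%N.
Proof.
move=> i1 i2 j1 j2; have [e idxe E] := idx_high i j; exists e => //.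
have := @rank_mx3_mul F (i *: W1 + W2) (j *: W1 + W3) (row3 1 0 0)
  (i * W1 0 0 + W2 0 0) (j * W1 0 0 + W3 0 0).
suff L (x : F) (u v : 'rV[F]_3) : x * u 0 1 + v 0 1 = 0 -> x * u 0 2 + v 0 2 = 0 ->
    x *: u + v = (x * u 0 0 + v 0 0) *: row3 1 0 0.
  by rewrite !L // => /(_ erefl erefl); move: E; rewrite !L //; rank_lia.
by move=> e1 e2; apply: row3P; rewrite !mxE /= ?e1 ?e2 ?mulr0 // mulr1.
Qed.

Lemma idx_ge_m1 (i j : F) :
  (i * W1 0 1 + W2 0 1) * (j * W1 0 2 + W3 0 2)
    = (i * W1 0 2 + W2 0 2) * (j * W1 0 1 + W3 0 1) ->
  exists2 e, idx e & (m + 1 <= e)%N.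
Proof.
move=> minor0; have [e idxe E] := idx_high i j; exists e => //.
have : \rank (mx3 (i *: W1 + W2) (j *: W1 + W3) (row3 1 0 0)) != 3%N.
  rewrite rank_mx3_full negbK /det3 !mxE /=; apply/eqP; move/eqP: minor0.
  by rewrite -subr_eq0 => /eqP minor0; rewrite -[RHS]minor0; ring.
by move: E (rk3 (i *: W1 + W2) (j *: W1 + W3) (row3 1 0 0)); rank_lia.
Qed.

(** The hypotheses make k W2 + l W3 equal to c times the commutator (0, -l, k), so the rank is 1.
    For m = n + 1 the exponent n + 2 is m + 1. *)
Lemma idx_ge_n2 (k l c : F) : (k != 0) || (l != 0) -> W1 = 0 ->
  k * W2 0 0 + l * W3 0 0 = 0 -> k * W2 0 1 + l * W3 0 1 = - (c * l) ->
  k * W2 0 2 + l * W3 0 2 = c * k -> exists2 e, idx e & (n + 2 <= e)%N.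
Proof.
move=> kl W10 e0 e1 e2; have [e idxe E] := idx_low 0 kl; exists e => //.
have W1E : W1 = 0 *: row3 0 (- l) k by rewrite W10 scale0r.
have W23E : k *: W2 + l *: W3 = c *: row3 0 (- l) k.
  by apply: row3P; rewrite !mxE /= ?e0 ?e1 ?e2 ?mulr0 ?mulrN.
by have := rank_mx3_mul W1E W23E; move: E; rank_lia.
Qed.

Lemma rank_high_le1 (i1 i2 i3 j1 j2 j3 d : F) : d != 0 ->
  (\rank (mx3 (i1 *: W1 + i2 *: W2 + i3 *: W3) (j1 *: W1 + j2 *: W2 + j3 *: W3)
     (row3 d 0 0)) <= 1)%N ->
  [/\ i1 * W1 0 1 + i2 * W2 0 1 + i3 * W3 0 1 = 0,
      i1 * W1 0 2 + i2 * W2 0 2 + i3 * W3 0 2 = 0,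
      j1 * W1 0 1 + j2 * W2 0 1 + j3 * W3 0 1 = 0
    & j1 * W1 0 2 + j2 * W2 0 2 + j3 * W3 0 2 = 0].
Proof.
move=> d0 /rank_mx3_le1[|c [e [/rowP Ec /rowP Ee]]].
  by apply: contra d0 => /eqP/rowP/(_ 0); rewrite row3E mxE => ->.
by split; [move: (Ec 1)|move: (Ec 2)|move: (Ee 1)|move: (Ee 2)];
  rewrite !mxE /= mulr0.
Qed.

Lemma idx_m2 : idx (m + 2)%N -> exists x y : F,
  [/\ W2 0 1 = x * W1 0 1, W2 0 2 = x * W1 0 2,
      W3 0 1 = y * W1 0 1 & W3 0 2 = y * W1 0 2].
Proof.
case/idx_forms => [[v [a [b [c [k [l /= [vmn _ t0 E]]]]]]]|].
  by have := rank_mx3_gt0 (a *: W1) (k *: W2 + l *: W3) t0; move: E vmn; rank_lia.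
move=> [i1 [i2 [i3 [j1 [j2 [j3 [d0 E]]]]]]].
have [|e1 e2 f1 f2] := @rank_high_le1 i1 i2 i3 j1 j2 j3 _ d0.
  by move: E; rank_lia.
set d := i2 * j3 - i3 * j2 in d0.
have cramer2 (u v t : F) : i1 * u + i2 * v + i3 * t = 0 -> j1 * u + j2 * v + j3 * t = 0 ->
    v = (i3 * j1 - i1 * j3) / d * u.
  move=> eu ev; apply: (mulfI d0); rewrite -mulrA mulrCA mulVKf //.
  have -> : d * v = j3 * (i1 * u + i2 * v + i3 * t) - i3 * (j1 * u + j2 * v + j3 * t)
    + (i3 * j1 - i1 * j3) * u by rewrite /d; ring.
  by rewrite eu ev !mulr0 subrr add0r.
have cramer3 (u v t : F) : i1 * u + i2 * v + i3 * t = 0 -> j1 * u + j2 * v + j3 * t = 0 ->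
    t = (i1 * j2 - i2 * j1) / d * u.
  move=> eu ev; apply: (mulfI d0); rewrite -mulrA mulrCA mulVKf //.
  have -> : d * t = i2 * (j1 * u + j2 * v + j3 * t) - j2 * (i1 * u + i2 * v + i3 * t)
    + (i1 * j2 - i2 * j1) * u by rewrite /d; ring.
  by rewrite eu ev !mulr0 subrr add0r.
exists ((i3 * j1 - i1 * j3) / d), ((i1 * j2 - i2 * j1) / d).
by split; [apply: cramer2 e1 f1|apply: cramer2 e2 f2|apply: cramer3 e1 f1|apply: cramer3 e2 f2].
Qed.

(* With w12 = w13 = 0 and an invertible lower right block of w, a subgroup of
   index p^(m+1) must be of the low form, with both power relations proportional
   to its commutator. *)
Lemma idx_m1 : W1 0 1 = 0 -> W1 0 2 = 0 ->
  W2 0 1 * W3 0 2 - W2 0 2 * W3 0 1 != 0 -> idx (m + 1)%N ->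
  [/\ m = (n + 1)%N, W1 0 0 = 0 & exists k l : F, (k != 0) || (l != 0) /\
    k ^+ 2 * W2 0 1 + k * l * (W3 0 1 + W2 0 2) + l ^+ 2 * W3 0 2 = 0].
Proof.
move=> w1 w2 D0.
have inv k l : k * W2 0 1 + l * W3 0 1 = 0 -> k * W2 0 2 + l * W3 0 2 = 0 -> k = 0 /\ l = 0.
  move=> e1 e2; split; apply: (mulIf D0); rewrite mul0r.
    have -> : k * (W2 0 1 * W3 0 2 - W2 0 2 * W3 0 1) =
      (k * W2 0 1 + l * W3 0 1) * W3 0 2 - (k * W2 0 2 + l * W3 0 2) * W3 0 1 by ring.
    by rewrite e1 e2 !mul0r subr0.
  have -> : l * (W2 0 1 * W3 0 2 - W2 0 2 * W3 0 1) =
      (k * W2 0 2 + l * W3 0 2) * W2 0 1 - (k * W2 0 1 + l * W3 0 1) * W2 0 2 by ring.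
  by rewrite e1 e2 !mul0r subr0.
case/idx_forms => [[v [a [b [c [k [l /= [vmn a0 t0 E]]]]]]]|].
  set t := cross _ _ in t0 E.
  have r1 : (\rank (mx3 (a *: W1) (k *: W2 + l *: W3) t) <= 1)%N.
    by move: E vmn; rank_lia.
  have mE : m = (n + v + 1)%N.
    by move: E r1 (rank_mx3_gt0 (a *: W1) (k *: W2 + l *: W3) t0); rank_lia.
  have [x [y [/rowP Ex /rowP Ey]]] := rank_mx3_le1 t0 r1.
  move: (Ex 0) (Ex 1) (Ex 2) (Ey 1) (Ey 2) t0; rewrite /t cross_row3 !mxE /= w1 w2.
  rewrite !mulr0 !subr0 sub0r.
  (* For v > 0 the commutator is a multiple of e1, so k W2 + l W3 vanishes off the first column; the
     invertible block gives k = l = 0 and t = 0. *)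
  have [v0|vn0] := eqVneq v 0%N; last first.
    rewrite !mul0r oppr0 !mulr0 => _ _ _ e1 e2; have [-> ->] := inv _ _ e1 e2.
    by rewrite !mulr0 subrr row3_0 eqxx.
  move=> ex0 ex1 ex2 ey1 ey2 t0.
  have kl : (k != 0) || (l != 0).
    apply: contraNT t0; rewrite negb_or !negbK => /andP[/eqP-> /eqP->].
    by rewrite !mulr0 subrr oppr0 row3_0.
  have x0 : x = 0.
    move: ex1 ex2 => /esym/eqP; rewrite mulrN oppr_eq0 !mulf_eq0 (negPf a0) /=.
    move=> /orP[/eqP //|/eqP l0] /esym/eqP; rewrite !mulf_eq0 (negPf a0) /=.
    by move=> /orP[/eqP //|/eqP k0]; move: kl; rewrite k0 l0 eqxx.
  split.
  - by rewrite mE v0 addn0.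
  - by move/eqP: ex0; rewrite x0 mul0r mulf_eq0 (negPf a0) => /eqP.
  exists k, l; split=> //.
  (* Off the first column, k W2 + l W3 is a multiple of (-al, ak), which is orthogonal to (k, l). *)
  have -> : k ^+ 2 * W2 0 1 + k * l * (W3 0 1 + W2 0 2) + l ^+ 2 * W3 0 2 =
    k * (k * W2 0 1 + l * W3 0 1) + l * (k * W2 0 2 + l * W3 0 2) by ring.
  by rewrite ey1 ey2; ring.
(* In the high form the determinant is (i2 j3 - i3 j2)^2 times that of the block, so the rank is 3
   and the exponent m. *)
move=> [i1 [i2 [i3 [j1 [j2 [j3 [d0 E]]]]]]].
have : \rank (mx3 (i1 *: W1 + i2 *: W2 + i3 *: W3) (j1 *: W1 + j2 *: W2 + j3 *: W3)
    (row3 (i2 * j3 - i3 * j2) 0 0)) != 3%N by apply/eqP; move: E; rank_lia.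
rewrite rank_mx3_full negbK => /eqP.
have -> : det3 (i1 *: W1 + i2 *: W2 + i3 *: W3) (j1 *: W1 + j2 *: W2 + j3 *: W3)
    (row3 (i2 * j3 - i3 * j2) 0 0) =
    (i2 * j3 - i3 * j2) * ((i2 * j3 - i3 * j2) * (W2 0 1 * W3 0 2 - W2 0 2 * W3 0 1)).
  by rewrite /det3 !mxE /= w1 w2; ring.
by move/eqP; rewrite !mulf_eq0 (negPf d0) (negPf D0).
Qed.

End Bounds.

(** * The listed matrices by rows *)

Section Named.
Variable p : nat.
Local Open Scope ring_scope.

Definition named_rows (c : matrix_name p) :
    'rV['F_p]_3 * 'rV['F_p]_3 * 'rV['F_p]_3 :=
  match c with
  | D1 => (row3 1 0 0, row3 0 0 1, row3 0 (-1) 0)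
  | D2 nu => (row3 1 0 0, row3 0 nu 1, row3 0 (-1) 0)
  | D3 nu => (row3 1 0 0, row3 0 1 0, row3 0 0 nu)
  | D4 r => (row3 1 0 0, row3 0 1 1, row3 0 (-1) r%:R)
  | D5 => (row3 1 0 0, row3 0 0 1, row3 0 1 0)
  | D6 => (row3 1 0 0, row3 0 1 0, row3 0 0 1)
  | D7 => (row3 1 0 0, row3 0 1 0, row3 0 1 1)
  | D8 t => (row3 0 0 1, row3 0 1 0, row3 t 0 0)
  | D9 => (row3 0 0 1, row3 1 0 0, row3 0 1 0)
  | E1 => (row3 0 0 0, row3 0 0 1, row3 0 (-1) 0)
  | E2 => (row3 0 0 0, row3 0 1 1, row3 0 (-1) 0)
  | E3 nu => (row3 0 0 0, row3 0 1 0, row3 0 0 nu)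
  | E4 r => (row3 0 0 0, row3 0 1 1, row3 0 (-1) r%:R)
  | E5 => (row3 0 0 0, row3 0 0 1, row3 0 1 0)
  | E6 => (row3 0 0 0, row3 0 1 0, row3 0 0 1)
  | E7 => (row3 0 0 0, row3 0 1 0, row3 0 1 1)
  | E8 => (row3 1 0 0, row3 0 0 1, row3 0 0 0)
  | E9 nu => (row3 1 0 0, row3 0 0 0, row3 0 0 nu)
  | E10 => (row3 0 0 0, row3 0 0 1, row3 1 0 0)
  | E11 => (row3 0 0 0, row3 1 0 0, row3 0 0 1)
  | E12 => (row3 0 0 1, row3 0 1 0, row3 0 0 0)
  | E13 => (row3 0 0 1, row3 0 0 0, row3 0 1 0)
  | E14 => (row3 0 0 1, row3 1 0 0, row3 0 0 0)
  | E15 t => (row3 0 0 1, row3 0 0 0, row3 t 0 0)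
  | F1 => (row3 1 0 0, row3 0 0 0, row3 0 0 0)
  | F2 => (row3 0 0 0, row3 0 0 1, row3 0 0 0)
  | F3 => (row3 0 0 0, row3 0 0 0, row3 0 0 1)
  | F4 => (row3 0 0 0, row3 1 0 0, row3 0 0 0)
  | F5 => (row3 0 0 0, row3 0 0 0, row3 0 0 0)
  | F6 => (row3 0 0 1, row3 0 0 0, row3 0 0 0)
  end.

Lemma ixE : [/\ ix 1 = 0, ix 2 = 1 & ix 3 = 2].
Proof. by split; apply: val_inj; rewrite /= inordK. Qed.

Lemma named_matrixE c :
  [/\ row 0 (named_matrix c) = (named_rows c).1.1,
      row 1 (named_matrix c) = (named_rows c).1.2
    & row 2 (named_matrix c) = (named_rows c).2].
Proof.
have [i1 i2 i3] := ixE.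
case: c => *; rewrite /named_matrix /e ?i1 ?i2 ?i3 /=;
  split; apply: row3P; rewrite !mxE /=;
  by rewrite ?(mulr0, mulr1, addr0, add0r, subr0, sub0r, oppr0).
Qed.

End Named.

(* On 'F_p, [ring] and [/=] start computing residues; plain rewriting does not. *)
Ltac simp01 := rewrite ?(mulr0, mul0r, mulr1, mul1r, addr0, add0r, subr0, sub0r,
  oppr0, mulrN, mulNr, opprK, expr1n, expr0n, oppr_eq0, oner_eq0).

(** * Evaluation of the bounds on the list *)

Section Classification.
Variables (p m n : nat) (eta : 'F_p) (c : matrix_name p) (idx : nat -> Prop).
Hypotheses (p_pr : prime p) (n_lt_m : (n < m)%N).
Hypotheses (eta_sq : odd p -> square_nonresidue eta) (adm : admissible eta c).
Local Open Scope ring_scope.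
Let W1 := (named_rows c).1.1.
Let W2 := (named_rows c).1.2.
Let W3 := (named_rows c).2.
Hypothesis idx_forms : index_forms m n W1 W2 W3 idx.
Hypothesis idx_low : low_index_ex n W1 W2 W3 idx.
Hypothesis idx_high : high_index_ex m W1 W2 W3 idx.

Let nu_n0 (nu : 'F_p) : nu = 1 \/ odd p /\ nu = eta -> nu != 0.
Proof.
by case=> [->|[/eta_sq[eta0 _] ->]]; rewrite ?oner_eq0.
Qed.

Let opp1_F2 : p = 2%N -> -1 = 1 :> 'F_p.
Proof. by move=> p2; rewrite p2; apply: val_inj. Qed.

(** Each group of matrices is kept away from the values of I_min that belong to the other two
    groups. *)
Lemma Imin_class :
  match c with
  | D2 _ | D3 _ | D4 _ | D6 | D7 | D8 _ | D9 | E8 | E9 _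
  | E12 | E13 | E14 | E15 _ => exists2 i, idx i & (i <= n)%N
  | F5 => forall i, idx i -> (n + 2 <= i)%N
  | _ => ~ idx n /\ exists2 i, idx i & (i <= n + 1)%N
  end.
Proof.
have L s k l := @idx_le_n _ _ _ _ _ _ idx_low s k l.
have L1 := idx_le_n1 idx_low.
have N1 := not_idx_n_row1 n_lt_m idx_forms.
have N23 := not_idx_n_row23 n_lt_m idx_forms.
have Nsk := not_idx_n_skew n_lt_m idx_forms.
have T i := @idx_trivial _ _ _ _ _ _ _ n_lt_m idx_forms i.
have z0 := row3_0 'F_p.
move: adm L L1 N1 N23 Nsk T; rewrite /W1 /W2 /W3; clear -z0 nu_n0 opp1_F2.
case: c => [|nu|nu|r| | | |t| | | |nu|r| | | | |nu| | | | | |t| | | | | |] /= adm L L1 N1 N23 Nsk T.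
(* The group of value n + 1: either W1 = 0, or W2 = W3 = 0, or the block is skew. D5 counts as skew
   since -1 = 1 for p = 2. *)
all: try (by split;
  [ first [exact: (N1 z0) | exact: (N23 z0 z0) | exact: (Nsk 1 erefl erefl erefl)
          | exact: (Nsk 1 erefl erefl (congr1 (fun x => row3 0 x 0) (esym (opp1_F2 adm))))]
  | apply: L1; apply/or3P;
    first [ by apply: Or31; rewrite row3_eq0 ?oner_eq0 ?andbF
          | by apply: Or32; rewrite row3_eq0 ?oner_eq0 ?andbF
          | by apply: Or33; rewrite row3_eq0 ?oner_eq0 ?andbF]]).
all: rewrite !row3E in L.
(* The arguments of [L] are s, k, l with nonzero determinant, one triple for each matrix of the
   first group. *)
- by case: adm => _ /nu_n0 nu0; apply: (L 0 1 0); simp01.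
- by apply: (L 0 1 0); simp01.
- by apply: (L 0 1 0); simp01.
- by apply: (L 0 1 0); simp01.
- by apply: (L 0 1 0); simp01.
- by apply: (L 0 0 1); simp01.
- by apply: (L 1 0 1); simp01.
- by apply: (L 0 1 1); simp01.
- by move/nu_n0: adm => nu0; apply: (L 0 0 1); simp01.
- by apply: (L 1 1 0); simp01.
- by apply: (L 1 0 1); simp01.
- by apply: (L 0 1 1); simp01.
- by apply: (L 0 0 1); simp01.
by move=> i; apply: T.
Qed.

Let F2P (a : 'F_p) : p = 2%N -> a = 0 \/ a = 1.
Proof.
move=> p2; move: a; rewrite p2 => -[[|[|//]] lt_a]; [left|right]; exact: val_inj.
Qed.

Let Fp_nat_n0 k : (0 < k < p)%N -> (k%:R : 'F_p) != 0.
Proof.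
by case/andP=> k0 kp; rewrite -(dvdn_pcharf (pchar_Fp p_pr)) gtnNdvd.
Qed.

Let Fp_r0 r : odd p /\ (1 <= r <= p - 2)%N -> (r%:R : 'F_p) != 0.
Proof.
have p1 := prime_gt1 p_pr; case=> _ /andP[r1 rp]; apply: Fp_nat_n0.
by move: r1 rp p1; clear; lia.
Qed.

(** The determinant of the lower right block of D4 and E4 is r + 1; the bound r <= p - 2 keeps it
    nonzero. *)
Let Fp_r1 r : odd p /\ (1 <= r <= p - 2)%N -> (r%:R + 1 : 'F_p) != 0.
Proof.
have p1 := prime_gt1 p_pr; case=> _ /andP[r1 rp]; rewrite natr1; apply: Fp_nat_n0.
by move: r1 rp p1; clear; lia.
Qed.

(** The bound n + 2 in the cases E1 to E6 serves to exclude I_max = m when m = n + 1. *)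
Lemma Imax_class :
  match c with
  | E14 | E15 _ | F1 | F4 | F5 | F6 => exists2 i, idx i & (m + 2 <= i)%N
  | D1 | D2 _ | D3 _ | D4 _ | D5 | D6 | D7 | E7 =>
      ~ idx (m + 2)%N /\ ~ idx (m + 1)%N
  | E1 | E2 | E5 | E6 => [/\ ~ idx (m + 2)%N, idx (m + 1)%N -> m = (n + 1)%N
      & exists2 i, idx i & (n + 2 <= i)%N]
  | E3 nu => [/\ ~ idx (m + 2)%N,
      idx (m + 1)%N -> m = (n + 1)%N /\ Fp_star_sq (- nu)
      & Fp_star_sq (- nu) -> exists2 i, idx i & (n + 2 <= i)%N]
  | E4 r => [/\ ~ idx (m + 2)%N,
      idx (m + 1)%N -> m = (n + 1)%N /\ Fp_star_sq (- (r%:R : 'F_p))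
      & Fp_star_sq (- (r%:R : 'F_p)) -> exists2 i, idx i & (n + 2 <= i)%N]
  | _ => ~ idx (m + 2)%N /\ exists2 i, idx i & (m + 1 <= i)%N
  end.
Proof.
(* The choice i = j = 0, that is g = a2 and h = a3, serves all matrices of the list that need a
   large index in high form. *)
have G2 := idx_ge_m2 idx_high; have := G2 0 0; rewrite !mul0r !add0r => {}G2.
have G1 := idx_ge_m1 idx_high; have := G1 0 0; rewrite !mul0r !add0r => {}G1.
have Gn k l d := @idx_ge_n2 _ _ _ _ _ _ idx_low k l d.
have X2 := idx_m2 idx_forms.
have X1 := idx_m1 idx_forms.
have z0 := row3_0 'F_p.
(* An isotropic vector of k^2 + d l^2 has k and l nonzero, and - d = (k / l)^2. *)
have root (k l d : 'F_p) : (k != 0) || (l != 0) -> d != 0 ->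
    k ^+ 2 + l ^+ 2 * d = 0 -> Fp_star_sq (- d).
  move=> kl d0 /eqP; rewrite addr_eq0 => /eqP E.
  have l0 : l != 0.
    apply: contraTneq kl => l0; move: E; rewrite l0 expr0n mul0r oppr0 => /eqP.
    by rewrite expf_eq0 /= => /eqP->; rewrite eqxx.
  have k0 : k != 0.
    apply: contraNneq d0 => k0; move/eqP: E; rewrite k0 expr0n /= eq_sym oppr_eq0.
    by rewrite mulf_eq0 expf_eq0 (negPf l0).
  exists (k / l); split; first by rewrite mulf_neq0 ?invr_eq0.
  by apply: (mulIf (expf_neq0 2 l0)); rewrite expr_div_n divfK ?expf_neq0 // E mulNr mulrC.
move: adm G2 G1 Gn X2 X1; rewrite /W1 /W2 /W3.
clear -z0 nu_n0 opp1_F2 root Fp_nat_n0 F2P Fp_r0 Fp_r1.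
case: c => [|nu|nu|r| | | |t| | | |nu|r| | | | |nu| | | | | |t| | | | | |] /= adm G2 G1 Gn X2 X1.
all: rewrite !row3E ?(mulr0, mul0r) in G2 G1 Gn X1 X2.
all: try (by apply: G2).
all: rewrite ?(mulr0, mul0r) in X1.
(* The proportionality to W1 required for m + 2 would give 1 = 0, or nu = 0 for E9. *)
all: assert (nX2 : ~ idx (m + 2)%N) by
  (move/X2=> [x [y []]]; rewrite ?mulr0 => e1 e2 e3 e4;
   match goal with
   | H : GRing.one _ = _ |- _ => move/eqP: H; rewrite oner_eq0; done
   | _ => move/nu_n0: adm; rewrite e4 eqxx; done
   end).
all: try (by split=> //; apply: G1).
(* For D1 to D7 the block is invertible, with determinant [D0], and w11 = 1 contradicts the w11 = 0
   that exponent m + 1 forces. *)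
- suff D0 : 0 - 1 * -1 != 0 :> 'F_p.
    by split=> // i1; have [_ /eqP + _] := X1 erefl erefl D0 i1; rewrite oner_eq0.
  by simp01.
- suff D0 : 0 - 1 * -1 != 0 :> 'F_p.
    by split=> // i1; have [_ /eqP + _] := X1 erefl erefl D0 i1; rewrite oner_eq0.
  by simp01.
- case: adm => _ /nu_n0 nu0; suff D0 : 1 * nu - 0 != 0.
    by split=> // i1; have [_ /eqP + _] := X1 erefl erefl D0 i1; rewrite oner_eq0.
  by simp01.
- have r1 := Fp_r1 adm; suff D0 : 1 * r%:R - 1 * -1 != 0 :> 'F_p.
    by split=> // i1; have [_ /eqP + _] := X1 erefl erefl D0 i1; rewrite oner_eq0.
  by simp01.
- suff D0 : 0 - 1 * 1 != 0 :> 'F_p.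
    by split=> // i1; have [_ /eqP + _] := X1 erefl erefl D0 i1; rewrite oner_eq0.
  by simp01.
- suff D0 : 1 * 1 - 0 != 0 :> 'F_p.
    by split=> // i1; have [_ /eqP + _] := X1 erefl erefl D0 i1; rewrite oner_eq0.
  by simp01.
- suff D0 : 1 * 1 - 0 != 0 :> 'F_p.
    by split=> // i1; have [_ /eqP + _] := X1 erefl erefl D0 i1; rewrite oner_eq0.
  by simp01.
(* From here on W1 = 0. The arguments of [Gn] are an isotropic (k, l) and the factor c with k W2 + l
   W3 = c (0, -l, k); for E3 and E4, k is a square root of -nu or -r and l = 1. *)
- have D0 : 0 - 1 * -1 != 0 :> 'F_p by simp01.
  split=> //; first by case/(X1 erefl erefl D0).
  by apply: (Gn 0 1 1); rewrite ?oner_neq0 ?orbT ?z0 //; simp01.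
- have D0 : 0 - 1 * -1 != 0 :> 'F_p by simp01.
  split=> //; first by case/(X1 erefl erefl D0).
  by apply: (Gn 0 1 1); rewrite ?oner_neq0 ?orbT ?z0 //; simp01.
- case: adm => _ /nu_n0 nu0; have D0 : 1 * nu - 0 != 0 by simp01.
  split=> //.
    case/(X1 erefl erefl D0) => mE _ [k [l [kl]]]; simp01 => E; split=> //.
    exact: root E.
  case=> a [_ Ea]; apply: (Gn a 1 (- a)); rewrite ?oner_neq0 ?orbT ?z0 //; simp01 => //.
  by rewrite -expr2 -Ea opprK.
- have r1 := Fp_r1 adm; have r0 := Fp_r0 adm.
  have D0 : 1 * r%:R - 1 * -1 != 0 :> 'F_p by simp01.
  split=> //.
    case/(X1 erefl erefl D0) => mE _ [k [l [kl]]]; rewrite addNr; simp01 => E; split=> //.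
    exact: root E.
  case=> a [_ Ea]; apply: (Gn a 1 (1 - a)); rewrite ?oner_neq0 ?orbT ?z0 //; simp01 => //.
    by rewrite opprB.
  by rewrite mulrBl mul1r -expr2 -Ea opprK.
- have D0 : 0 - 1 * 1 != 0 :> 'F_p by simp01.
  split=> //; first by case/(X1 erefl erefl D0).
  by apply: (Gn 0 1 1); rewrite ?oner_neq0 ?orbT ?z0 //; simp01; rewrite ?opp1_F2.
- have D0 : 1 * 1 - 0 != 0 :> 'F_p by simp01.
  split=> //; first by case/(X1 erefl erefl D0).
  by apply: (Gn 1 1 1); rewrite ?oner_neq0 ?orbT ?z0 //; simp01; rewrite ?opp1_F2.
- have D0 : 1 * 1 - 0 != 0 :> 'F_p by simp01.
  (* For E7 the form is k^2 + kl + l^2, which has no nontrivial zero over F_2. *)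
  split=> //; case/(X1 erefl erefl D0) => _ _ [k [l []]].
  have e2 : 1 + 1 = 0 :> 'F_p by rewrite -[X in X + _](opp1_F2 adm) addNr.
  case: (F2P k adm) => ->; case: (F2P l adm) => ->; rewrite ?eqxx // ?expr1n ?expr0n /=;
    simp01 => // _ /eqP; simp01; rewrite ?e2 ?add0r ?oner_eq0 //.
all: by split.
Qed.

End Classification.

(** * Comparison of the bounds with I_min and I_max *)

Theorem theorem4p3 (gT : finGroupType) (G : {group gT}) (p m1 m2 m3 : nat)
    (Imin Imax : nat) (eta : 'F_p) (c : matrix_name p) :
  prime p ->
  p.-group G ->
  'm(G) = 3 ->
  'Phi(G) \subset 'Z(G) ->
  p.-abelem G^`(1) -> #|G^`(1)| = (p ^ 3)%N ->
  abelian_type (G / G^`(1)) = [:: (p ^ m1)%N; (p ^ m2)%N; (p ^ m3)%N] ->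
  (0 < m3)%N -> (m2 < m1)%N -> m2 = m3 -> (p = 2 -> (1 < m2)%N) ->
  (odd p -> square_nonresidue eta) ->
  admissible eta c ->
  is_characteristic_matrix m1 m2 m3 G (named_matrix c) ->
  is_Imin p G Imin ->
  is_Imax p G Imax ->
  (Imin = m3 ->
     match c with
     | D2 _ | D3 _ | D4 _ | D6 | D7 | D8 _ | D9 | E8 | E9 _
     | E12 | E13 | E14 | E15 _ => True
     | _ => False
     end) /\
  (Imin = (m3 + 1)%N ->
     match c with
     | D1 | D5 | E1 | E2 | E3 _ | E4 _ | E5 | E6 | E7 | E10 | E11
     | F1 | F2 | F3 | F4 | F6 => True
     | _ => False
     end) /\
  (Imin = (m3 + 2)%N ->
     match c with
     | F5 => True
     | _ => False
     end) /\
  (Imax = (m1 + 2)%N ->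
     match c with
     | E14 | E15 _ | F1 | F4 | F5 | F6 => True
     | _ => False
     end) /\
  (Imax = (m1 + 1)%N ->
     match c with
     | D8 _ | D9 => True
     | E1 | E2 => m1 = (m2 + 1)%N
     | E3 nu => m1 = (m2 + 1)%N /\ Fp_star_sq (- nu)%R
     | E4 r => m1 = (m2 + 1)%N /\ Fp_star_sq (- (r%:R : 'F_p))%R
     | E5 | E6 => m1 = (m2 + 1)%N
     | E8 | E9 _ | E10 | E11 | E12 | E13 | F2 | F3 => True
     | _ => False
     end) /\
  (Imax = m1 ->
     match c with
     | D1 | D2 _ | D3 _ | D4 _ | D5 | D6 | D7 => True
     | E1 | E2 => (m2 + 1 < m1)%N
     | E3 nu => (m2 + 1 < m1)%N \/ ~ Fp_star_sq (- nu)%R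
     | E4 r => (m2 + 1 < m1)%N \/ ~ Fp_star_sq (- (r%:R : 'F_p))%R
     | E5 | E6 => (m2 + 1 < m1)%N
     | E7 => True
     | _ => False
     end).

Proof.
move=> p_pr pG _ PhiZ abG' cG' _ m3_gt0 m21 m23 p2 eta_sq adm.
case=> a1 [a2 [a3 [[a1G a2G a3G] [dp [[o1 o2 o3] [w1 w2 w3]]]]]].
case=> [[Hmin [A1min imin]] minle] [[Hmax [A1max imax]] maxle].
subst m3; set w := named_matrix c in w1 w2 w3.
have [i1 i2 i3] := ixE.
have pow3_row i : pow3 [~ a2, a3] [~ a3, a1] [~ a1, a2] (row i w) =
    [~ a2, a3] ^+ w i (ix 1) * [~ a3, a1] ^+ w i (ix 2) * [~ a1, a2] ^+ w i (ix 3).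
  by rewrite /pow3 !mxE i1 i2 i3.
rewrite -pow3_row i1 in w1; rewrite -pow3_row i2 in w2; rewrite -pow3_row i3 in w3.
have [r1 r2 r3] := named_matrixE c.
have forms := A1_index_forms p_pr pG PhiZ abG' cG' m3_gt0 m21 p2 a1G a2G a3G dp
  o1 o2 o3 w1 w2 w3.
have low := A1_low_index_ex p_pr pG PhiZ abG' cG' m3_gt0 m21 p2 a1G a2G a3G dp
  o1 o2 o3 w1 w2 w3.
have high := A1_high_index_ex p_pr pG PhiZ abG' cG' m3_gt0 m21 p2 a1G a2G a3G dp
  o1 o2 o3 w1 w2 w3.
rewrite /w r1 r2 r3 in forms low high.
have cmin := Imin_class m21 eta_sq adm forms low.
have cmax := Imax_class p_pr eta_sq adm forms low high.
have idx_min : A1_exponent p G Imin by exists Hmin.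
have idx_max : A1_exponent p G Imax by exists Hmax.
have min_le e : (exists2 i, A1_exponent p G i & (i <= e)%N) -> (Imin <= e)%N.
  case=> i [H /minle + iH]; rewrite iH leq_exp2l ?prime_gt1 //; exact: leq_trans.
have max_ge e : (exists2 i, A1_exponent p G i & (e <= i)%N) -> (e <= Imax)%N.
  case=> i [H /maxle + iH] ei; rewrite iH leq_exp2l ?prime_gt1 //; exact: leq_trans.
have min_neq e : ~ A1_exponent p G e -> Imin <> e by move=> ne E; apply: ne; rewrite -E.
have max_neq e : ~ A1_exponent p G e -> Imax <> e by move=> ne E; apply: ne; rewrite -E.
have max_eq e : Imax = e -> A1_exponent p G e by move=> <-.
move: (A1_exponent p G) idx_min cmin cmax min_le max_ge min_neq max_neq max_eq.
move=> idx idx_min cmin cmax min_le max_ge min_neq max_neq max_eq.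
move: cmin cmax; clear -m21 min_le max_ge min_neq max_neq max_eq idx_min.
case: c => [|nu|nu|r| | | |t| | | |nu|r| | | | |nu| | | | | |t| | | | | |] cmin cmax.
(* As I_min and I_max are extremal and attained, existence statements become inequalities for them
   and exclusions become disequalities. *)
all: repeat match goal with
  | H : _ /\ _ |- _ => destruct H
  | H : and3 _ _ _ |- _ => destruct H
  | H : @ex2 nat _ _ |- _ => first [apply min_le in H | apply max_ge in H]
  | H : ~ _ |- _ => pose proof (min_neq _ H); apply max_neq in H
  end.
all: try specialize (cmin _ idx_min).
all: do 5?split; move=> E; try exact: I;
  try (exfalso; lia).
all: try match goal with H : _ -> _ |- _ => exact (H (max_eq _ E)) end.
all: try lia.
(* What is left is E3 and E4 with I_max = m1: if m1 <= m2 + 1, a square root would give a subgroup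
   of exponent at least m2 + 2 > m1. *)
all: have [lt_m|le_m] := ltnP (m2 + 1) m1; [by left | right=> sq].
all: match goal with H : _ -> @ex2 nat _ _ |- _ => move/max_ge: (H sq); lia end.
Qed.
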